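(* Let $F$ be the universal Buchstaber formal group law, with coefficient ring $\Lambda$. Under an identification (isomorphism of graded rings) $\Lambda\otimes\mathbb{Q}=\mathbb{Q}[p_1,p_2,p_3,p_4]$, where $p_1,p_2,p_3,p_4$ are polynomial variables of degrees $2,4,6,8$, one has, over $\mathbb{Q}[p_1,p_2,p_3,p_4]$, $$F(x,y)=\frac{x^2A(y)-y^2A(x)}{xB(y)-yB(x)}\qquad\text{with } A(x)=\mathcal{A}(x),\quad B(x)=\mathcal{B}(x),$$ and the logarithm of $F$ is $$\log_F(x)=\int_0^x\frac{dt}{\mathcal{B}(t)}.$$ Here $\mathcal{A}$ and $\mathcal{B}$ are the explicit series over $\mathbb{Q}[p_1,p_2,p_3,p_4]$ defined in the context.
   Context: All rings are commutative with unit and formal group laws are one-dimensional and commutative. A Buchstaber formal group law over a ring $R$ is a formal group law over $R$ of the form $F(x,y)=\frac{x^2A(y)-y^2A(x)}{xB(y)-yB(x)}$ for some $A,B\in R[[x]]$ with $A(0)=B(0)=1$. The universal Buchstaber formal group law $F$, over the ring $\Lambda$, is the universal example: every Buchstaber formal group law over any ring $R$ is the image of $F$ under a unique ring homomorphism $\Lambda\to R$. The ring $\Lambda$ is a quotient of the Lazard ring and is graded so that the coefficient of $x^iy^j$ in $F$ has degree $2(i+j-1)$. The series $A$ and $B$ in such a presentation of a given $F$ are determined by $F$ only up to adding $k_1x^2$ to $A$ and $k_2x$ to $B$ ($k_1,k_2$ constants); the normalization used here is $B(x)=\frac{\partial F}{\partial y}(x,0)$ and $A$ with zero coefficient at $x^2$.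 The logarithm $\log_F$ of a formal group law $F$ over a $\mathbb{Q}$-algebra is the unique series $\log_F(x)=x+\cdots$ with $\log_F(F(x,y))=\log_F(x)+\log_F(y)$. Definition of the series over $\mathbb{Q}[p_1,p_2,p_3,p_4]$: put $\mathcal{R}(x)=\sqrt{1+p_1x+p_2x^2+p_3x^3+p_4x^4}$ (the square root with constant term $1$). The series $\mathcal{B}(x)$ is the unique formal power series with $\mathcal{B}(0)=1$ such that, with $\mu(x):=x/\mathcal{B}(x)$, $$\mathcal{B}(x)=\frac{\mathcal{R}(\mu(x))}{\mu'(x)}.$$ Equivalently, $\mathcal{B}(0)=1$ and $\mathcal{B}^2(\mathcal{B}-x\mathcal{B}')^2=\mathcal{B}^4+p_1x\mathcal{B}^3+p_2x^2\mathcal{B}^2+p_3x^3\mathcal{B}+p_4x^4$. Finally $$\mathcal{A}(x):=\mathcal{B}^2(x)-\tfrac12x\mathcal{B}(x)\mathcal{B}'(x)+\tfrac14p_1x\mathcal{B}(x)-\left(\tfrac1{16}p_1^2-\tfrac14p_2\right)x^2.$$ *)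

(* Defs.v *)
From HB Require Import structures.
From mathcomp Require Import all_boot all_order all_algebra.
From mathcomp Require Import boolp ssrcomplements mpoly ring.

Set Implicit Arguments.
Unset Strict Implicit.
Unset Printing Implicit Defensive.

Import GRing.Theory.
Local Open Scope ring_scope.

Lemma lepm_mdeg n (m1 m2 : 'X_{1..n}) : (m1 <= m2)%MM -> (mdeg m1 <= mdeg m2)%N.
Proof. by move=> le; rewrite -(submK le) mdegD leq_addl. Qed.

Lemma lep0m n (m : 'X_{1..n}) : (0 <= m)%MM.
Proof. by apply/mnm_lepP => i; rewrite mnm0E. Qed.

(** Formal power series in [n] variables over [R]. *)
Record mps (n : nat) (R : Type) := MPS { mcoef :> 'X_{1..n} -> R }.

Lemma mpsP n R (f g : mps n R) : f =1 g -> f = g.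
Proof. by case: f g => f [g] /= fg; congr MPS; apply: funext. Qed.

HB.instance Definition _ n R := gen_eqMixin (mps n R).
HB.instance Definition _ n R := gen_choiceMixin (mps n R).

Section Zmodule.
Variables (n : nat) (R : comPzRingType).
Implicit Types f g h : mps n R.

Definition mps0 : mps n R := MPS (fun=> 0).
Definition mpsN f : mps n R := MPS (fun m => - f m).
Definition mpsD f g : mps n R := MPS (fun m => f m + g m).

Lemma mpsDA : associative mpsD.
Proof. by move=> f g h; apply: mpsP => m /=; rewrite addrA. Qed.
Lemma mpsDC : commutative mpsD.
Proof. by move=> f g; apply: mpsP => m /=; rewrite addrC. Qed.
Lemma mps0D : left_id mps0 mpsD.
Proof. by move=> f; apply: mpsP => m /=; rewrite add0r. Qed.
Lemma mpsND : left_inverse mps0 mpsN mpsD.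
Proof. by move=> f; apply: mpsP => m /=; rewrite addNr. Qed.

HB.instance Definition _ :=
  GRing.isZmodule.Build (mps n R) mpsDA mpsDC mps0D mpsND.

Lemma mcoef0 m : (0 : mps n R) m = 0. Proof. by []. Qed.
Lemma mcoefD f g m : (f + g) m = f m + g m. Proof. by []. Qed.
Lemma mcoefN f m : (- f) m = - f m. Proof. by []. Qed.
Lemma mcoefB f g m : (f - g) m = f m - g m. Proof. by []. Qed.

Lemma mcoef_sum I (r : seq I) (P : pred I) (F : I -> mps n R) m :
  (\sum_(i <- r | P i) F i) m = \sum_(i <- r | P i) F i m.
Proof.
by elim/big_rec2: _ => [|i x y _ <-]; rewrite ?mcoef0 ?mcoefD.
Qed.

End Zmodule.

HB.lock Definition mpsM n (R : comPzRingType) (f g : mps n R) : mps n R :=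
  MPS (fun m =>
    \sum_(k : 'X_{1..n < (mdeg m).+1} | (k <= m)%MM) f k * g (m - k)%MM).
Arguments mpsM {n R} f g.

Section Ring.
Variables (n : nat) (R : comPzRingType).
Implicit Types (f g h : mps n R) (m : 'X_{1..n}).

Definition mpsC (c : R) : mps n R := MPS (fun m => if m == 0%MM then c else 0).
Definition mpsX (i : 'I_n) : mps n R := MPS (fun m => (m == U_(i)%MM)%:R).

Lemma mpsM_bound b f g m : (mdeg m < b)%N ->
  mpsM f g m = \sum_(k : 'X_{1..n < b} | (k <= m)%MM) f k * g (m - k)%MM.
Proof.
move=> lt_mb; rewrite mpsM.unlock /=.
pose I1 : subFinType _ := 'X_{1..n < (mdeg m).+1}.
pose I2 : subFinType _ := 'X_{1..n < b}.
rewrite (big_sub_widen I1 I2 (fun k => (k <= m)%MM)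
  (fun k => f k * g (m - k)%MM)) /=; last by move=> k /leq_trans; apply.
apply: eq_bigl => k; rewrite andb_idr // => le_km.
by rewrite ltnS; apply: lepm_mdeg.
Qed.

Lemma mpsM_rev b f g m : (mdeg m < b)%N ->
  mpsM f g m = \sum_(k : 'X_{1..n < b} | (k <= m)%MM) f (m - k)%MM * g k.
Proof.
move=> lt; rewrite (mpsM_bound f g lt).
have pr (h : 'X_{1..n}) : (mdeg (m - h)%MM < b)%N.
  by apply: leq_ltn_trans lt; apply: mdegB.
pose F (k : 'X_{1..n < b}) := BMultinom (pr k).
have inv_F (h : 'X_{1..n}): (h <= m)%MM -> (m - (m - h))%MM = h.
  by move=> le_hm; rewrite submBA // addmC addmK.
rewrite (reindex_onto F F) //=; last first.
  by move=> h /inv_F eqh; apply/eqP; rewrite eqE /= eqh.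
apply/esym/eq_big => [h /=|h /inv_F -> //]; apply/esym; rewrite lem_subr eqE /=.
by apply/eqP/idP => [<-|/inv_F //]; apply/mnm_lepP=> i; rewrite !mnmBE leq_subr.
Qed.

Lemma mpsMC : commutative (@mpsM n R).
Proof.
move=> f g; apply: mpsP => m.
rewrite (mpsM_bound f g (ltnSn _)) (mpsM_rev g f (ltnSn _)).
by apply: eq_bigr => k _; rewrite mulrC.
Qed.

Lemma mpsMA : associative (@mpsM n R).
Proof.
move=> p q r; apply: mpsP => mi; pose b := (mdeg mi).+1.
have ltb : (mdeg mi < b)%N by [].
rewrite (mpsM_bound _ _ ltb) (mpsM_rev _ _ ltb).
have h m: (mdeg (mi - m)%MM < b)%N by exact/(leq_ltn_trans (mdegB mi m)).
pose coef3 mj mk := p mj * (q (mi - mj - mk)%MM * r mk).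
transitivity (\sum_(mj : 'X_{1..n < b} | (mj <= mi)%MM)
                \sum_(mk : 'X_{1..n < b} | (mk <= mi - mj)%MM)
                   coef3 mj mk).
  by apply/eq_bigr=> mj _; rewrite (mpsM_rev _ _ (h _)) big_distrr.
pose P (mj : 'X_{1..n < b}) := (mj <= mi)%MM.
rewrite (exchange_big_dep P) // {}/P; last first.
  by move=> mj mk _ /lepm_trans; apply; apply/lem_subr.
apply/eq_bigr=> mk /mnm_lepP le_mk_mi.
transitivity (\sum_(mj : 'X_{1..n < b} | (mj <= mi - mk)%MM) coef3 mj mk).
+ apply/eq_bigl=> m /=.
  apply/idP/idP => [/andP[/mnm_lepP le1 /mnm_lepP le2]|le1].
  * apply/mnm_lepP => i; rewrite mnmBE /leq subnBA // addnC -subnBA //.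
    by rewrite -mnmBE; apply/le2.
  * have le2: (m <= mi)%MM by rewrite (lepm_trans le1) ?lem_subr.
    rewrite le2; apply/mnm_lepP=> i; rewrite mnmBE /leq.
    move/mnm_lepP: le2 => le2; rewrite subnBA // addnC.
    by rewrite -subnBA //; move/mnm_lepP/(_ i): le1; rewrite mnmBE.
rewrite (mpsM_bound _ _ (h _)) /coef3 big_distrl /=.
by apply/eq_bigr=> mj le_mj_miBk; rewrite !mulrA !submDA addmC.
Qed.

Lemma mpsCM c f m : mpsM (mpsC c) f m = c * f m.
Proof.
rewrite mpsM.unlock /= (bigD1 (bm0 : 'X_{1..n < (mdeg m).+1})) ?lep0m //=.
rewrite eqxx subm0 big1 ?addr0 // => k /andP[_].
by rewrite bmeqP /= => /negbTE ->; rewrite mul0r.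
Qed.

Lemma mps1M : left_id (mpsC 1) (@mpsM n R).
Proof. by move=> f; apply: mpsP => m; rewrite mpsCM mul1r. Qed.

Lemma mpsMDl : left_distributive (@mpsM n R) +%R.
Proof.
move=> f g h; apply: mpsP => m; rewrite mcoefD mpsM.unlock /= -big_split /=.
by apply: eq_bigr => k _; rewrite mulrDl.
Qed.

HB.instance Definition _ :=
  GRing.Zmodule_isComPzRing.Build (mps n R) mpsMA mpsMC mps1M mpsMDl.

Lemma mcoefM f g m : (f * g) m =
  \sum_(k : 'X_{1..n < (mdeg m).+1} | (k <= m)%MM) f k * g (m - k)%MM.
Proof. by rewrite [f * g]/GRing.mul /= mpsM.unlock. Qed.

Lemma mcoefC c m : mpsC c m = if m == 0%MM then c else 0. Proof. by []. Qed.
Lemma mcoef1 m : (1 : mps n R) m = (m == 0%MM)%:R.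
Proof. by rewrite [LHS]mcoefC; case: eqP. Qed.
Lemma mcoefCM c f m : (mpsC c * f) m = c * f m. Proof. exact: mpsCM. Qed.

End Ring.

Arguments mpsC {n R} c.
Arguments mpsX {n R} i.

Lemma mps_oner_neq0 n (R : comNzRingType) : (1 : mps n R) != 0.
Proof.
apply/eqP => /(congr1 (fun f : mps n R => f 0%MM)) /eqP.
by rewrite mcoef1 mcoef0 eqxx oner_eq0.
Qed.

HB.instance Definition _ n (R : comNzRingType) :=
  GRing.PzSemiRing_isNonZero.Build (mps n R) (@mps_oner_neq0 n R).

(** Substitution [f(u_1, ..., u_k)], meaningful when every [u_i] has zero constant
    term: [u^j] then has no term of total degree less than [mdeg j], so that the
    truncated sum below contains all the contributions to the coefficient of [m]. *)
HB.lock Definition mps_subst k n (R : comPzRingType) (f : mps k R)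
    (u : k.-tuple (mps n R)) : mps n R :=
  MPS (fun m => \sum_(j : 'X_{1..k < (mdeg m).+1})
                   f j * (\prod_(i < k) tnth u i ^+ j i) m).

Arguments mps_subst {k n R} f u.

Notation "f \So u" := (mps_subst f u) (at level 50).

Definition mps_map n (R S : Type) (phi : R -> S) (f : mps n R) : mps n S :=
  MPS (fun m => phi (f m)).

Definition mps_deriv n (R : comPzRingType) (i : 'I_n) (f : mps n R) : mps n R :=
  MPS (fun m => f (m + U_(i))%MM *+ (m i).+1).

(** [1 / f], for [f] with constant term [1], is the geometric series in [1 - f];
    see [mpsV_mul]. *)
Definition mpsV n (R : comPzRingType) (f : mps n R) : mps n R :=
  (MPS (fun=> 1) : mps 1 R) \So [tuple 1 - f].

(** [\int_0^x f(t) dt] *)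
Definition mps_int (R : lmodType rat) (f : mps 1 R) : mps 1 R :=
  MPS (fun m => if m == 0%MM then 0
                else (mdeg m)%:R^-1 *: f (m - U_(ord0))%MM).

Section Truncation.
Variables (n : nat) (R : comPzRingType).
Implicit Types (f g h : mps n R) (m : 'X_{1..n}).

Definition eqtrunc d f g := forall m, (mdeg m < d)%N -> f m = g m.

Lemma eqtrunc_eq f g : (forall d, eqtrunc d f g) -> f = g.
Proof. by move=> fg; apply: mpsP => m; apply: (fg (mdeg m).+1). Qed.

Lemma eqtruncW d e f g : (d <= e)%N -> eqtrunc e f g -> eqtrunc d f g.
Proof. by move=> le fg m lt; apply: fg; apply: leq_trans le. Qed.

Lemma eqtrunc_sym d f g : eqtrunc d f g -> eqtrunc d g f.
Proof. by move=> fg m lt; rewrite fg. Qed.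

Lemma eqtruncD d f f' g g' :
  eqtrunc d f f' -> eqtrunc d g g' -> eqtrunc d (f + g) (f' + g').
Proof. by move=> ff gg m lt; rewrite !mcoefD ff ?gg. Qed.

Lemma eqtruncN d f f' : eqtrunc d f f' -> eqtrunc d (- f) (- f').
Proof. by move=> ff m lt; rewrite !mcoefN ff. Qed.

Lemma eqtruncM d f f' g g' :
  eqtrunc d f f' -> eqtrunc d g g' -> eqtrunc d (f * g) (f' * g').
Proof.
move=> ff gg m lt; rewrite !mcoefM; apply: eq_bigr => k le.
rewrite ff ?gg //; first by apply: leq_ltn_trans lt; apply: mdegB.
by apply: leq_ltn_trans lt; apply: lepm_mdeg.
Qed.

Lemma eqtruncX d f f' e : eqtrunc d f f' -> eqtrunc d (f ^+ e) (f' ^+ e).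
Proof.
by move=> ff; elim: e => // e IH; rewrite !exprS; apply: eqtruncM.
Qed.

Lemma mul_ord d e f g : eqtrunc d f 0 -> eqtrunc e g 0 -> eqtrunc (d + e) (f * g) 0.
Proof.
move=> f0 g0 m lt; rewrite mcoefM mcoef0 big1 // => k le.
have dE : mdeg m = (mdeg k + mdeg (m - k)%MM)%N.
  by rewrite -mdegD addmC submK.
have [lk|lk] := ltnP (mdeg k) d; first by rewrite f0 // mcoef0 mul0r.
rewrite g0 ?mulr0 // -(ltn_add2l d); apply: leq_ltn_trans lt.
by apply: leq_trans (eq_leq (esym dE)); rewrite leq_add2r.
Qed.

Lemma exp_ord f e : f 0%MM = 0 -> eqtrunc e (f ^+ e) 0.
Proof.
move=> f0; elim: e => [|e IH]; first by move=> m.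
rewrite exprS -add1n; apply: mul_ord => // m.
by rewrite ltnS leqn0 mdeg_eq0 => /eqP ->.
Qed.

Lemma eqtrunc_ord1 f : f 0%MM = 0 -> eqtrunc 1 f 0.
Proof. by move=> f0; rewrite -[f]expr1; apply: exp_ord. Qed.

Lemma mul_ord1 d f g : eqtrunc d f 0 -> g 0%MM = 0 -> eqtrunc d.+1 (f * g) 0.
Proof.
by move=> f0 g0; rewrite -(addn1 d); apply: mul_ord => //; apply: eqtrunc_ord1.
Qed.

Lemma mcoefM0 f g : (f * g) 0%MM = f 0%MM * g 0%MM.
Proof.
rewrite mcoefM (bigD1 (bm0 : 'X_{1..n < (mdeg (0%MM : 'X_{1..n})).+1})) ?lep0m //=.
rewrite sub0m big1 ?addr0 // => k /andP[/lepm_mdeg le].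
have /eqP k0 : (k : 'X_{1..n}) == 0%MM.
  by rewrite -mdeg_eq0 -leqn0 (leq_trans le) // mdeg0.
by rewrite bmeqP /= k0 eqxx.
Qed.

Lemma eqtrunc_subst1 d (f : mps 1 R) g g' : eqtrunc d g g' ->
  eqtrunc d (f \So [tuple g]) (f \So [tuple g']).
Proof.
move=> gg m lt; rewrite mps_subst.unlock /=; apply: eq_bigr => j _; congr (_ * _).
by rewrite !big_ord1; apply: eqtruncX gg _ lt.
Qed.

Lemma subst1_0 (f : mps 1 R) g : g 0%MM = 0 -> (f \So [tuple g]) 0%MM = f 0%MM.
Proof.
move=> g0; rewrite mps_subst.unlock /=.
rewrite (bigD1 (bm0 : 'X_{1..1 < (mdeg (0%MM : 'X_{1..n})).+1})) //= [X in _ + X]big1.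
  by rewrite ?big_ord1 mnm0E expr0 mcoef1 eqxx mulr1 addr0.
move=> j; have le : (mdeg j <= mdeg (0%MM : 'X_{1..n}))%N := bmdeg j.
have /eqP j0 : (j : 'X_{1..1}) == 0%MM.
  by rewrite -mdeg_eq0 -leqn0 (leq_trans le) // mdeg0.
by rewrite bmeqP /= j0 eqxx.
Qed.

Lemma mpsV_trunc N f : f 0%MM = 1 ->
  eqtrunc N (mpsV f) (\sum_(k < N) (1 - f) ^+ k).
Proof.
move=> f1 m lt; rewrite mcoef_sum /mpsV mps_subst.unlock /=.
have u0 : (1 - f) 0%MM = 0 by rewrite mcoefB f1 mcoef1 eqxx subrr.
transitivity (\sum_(k < (mdeg m).+1) ((1 - f) ^+ k) m); last first.
  rewrite (big_ord_widen N (fun k => ((1 - f) ^+ k) m)) // big_mkcond.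
  by apply: eq_bigr => k _; case: ltnP => // lk; rewrite exp_ord.
pose c (j : 'X_{1..1 < (mdeg m).+1}) : 'I_(mdeg m).+1 :=
  Ordinal (bmdeg j).
have c'P (i : 'I_(mdeg m).+1) : (mdeg [multinom (i : nat) | _ < 1] < (mdeg m).+1)%N.
  by rewrite mdegE big_ord1 mnmE.
rewrite (reindex (fun i => BMultinom (c'P i))) /=; last first.
  exists c => [i _|j _]; first by apply: val_inj; rewrite /= mdegE big_ord1 mnmE.
  by apply: val_inj; apply/mnmP => i; rewrite mnmE ord1 /= mdegE big_ord1.
by apply: eq_bigr => i _; rewrite mul1r big_ord1 mnmE.
Qed.

Lemma mpsV_mul f : f 0%MM = 1 -> f * mpsV f = 1.
Proof.
move=> f1; apply: eqtrunc_eq => N.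
have u0 : (1 - f) 0%MM = 0 by rewrite mcoefB f1 mcoef1 eqxx subrr.
have fS : f * (\sum_(k < N) (1 - f) ^+ k) = 1 - (1 - f) ^+ N.
  by rewrite -[RHS]opprB subrX1 -mulNr; congr (_ * _); rewrite addrAC subrr add0r opprK.
move=> m lt; rewrite (eqtruncM (fun _ _ => erefl) (mpsV_trunc (N := N) f1) lt).
by rewrite fS mcoefB (exp_ord u0 lt) mcoef0 subr0.
Qed.

Definition causal (Phi : mps n R -> mps n R) :=
  forall d f g, eqtrunc d f g -> eqtrunc d.+1 (Phi f) (Phi g).

Lemma causal_fix Phi : causal Phi -> exists f, Phi f = f.
Proof.
move=> cPhi; pose it k := iter k Phi 0.
have itE d k : (d <= k)%N -> eqtrunc d (it k) (it d).
  elim: d k => [|d IH] [|k] //; rewrite ltnS => le.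
  by rewrite /it /=; apply: cPhi; apply: IH.
exists (MPS (fun m => it (mdeg m).+1 m)); apply: mpsP => m /=.
apply: (cPhi (mdeg m)) => // k lt /=.
by rewrite (itE _ _ lt).
Qed.

Lemma causal_uniq Phi f g : causal Phi -> Phi f = f -> Phi g = g -> f = g.
Proof.
move=> cPhi ff gg; apply: eqtrunc_eq; elim=> [//|d IH].
by rewrite -ff -gg; apply: cPhi.
Qed.

End Truncation.

Section OneVariable.
Variable R : comPzRingType.
Implicit Types (f g : mps 1 R) (m : 'X_{1..1}).
Local Notation i0 := (ord0 : 'I_1).

Definition euler f : mps 1 R := MPS (fun m => f m *+ mdeg m).

Lemma eulerM f g : euler (f * g) = euler f * g + f * euler g.
Proof.
apply: mpsP => m; rewrite mcoefD /= !mcoefM -sumrMnl -big_split /=.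
apply: eq_bigr => k le.
by rewrite mulrnAl mulrnAr -mulrnDr -mdegD addmC submK.
Qed.

Lemma mnm1E0 m : m = (U_(i0) *+ mdeg m)%MM.
Proof. by apply/mnmP => i; rewrite mulmnE mdegE big_ord1 mnmE ord1 eqxx mul1n. Qed.

Lemma mcoefXM0 f : (mpsX i0 * f) 0%MM = 0.
Proof. by rewrite mcoefM0 /= eq_sym -mdeg_eq0 mdeg1 mul0r. Qed.

Lemma mcoefXMS f m : (mpsX i0 * f) (m + U_(i0))%MM = f m.
Proof.
rewrite mcoefM.
have lt : (mdeg (U_(i0) : 'X_{1..1}) < (mdeg (m + U_(i0))%MM).+1)%N.
  by rewrite mdegD ltnS leq_addl.
rewrite (bigD1 (BMultinom lt)) ?lem_addl //=.
rewrite eqxx mul1r addmK big1 ?addr0 // => k /andP[_].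
by rewrite bmeqP /= => /negbTE ->; rewrite mul0r.
Qed.

Lemma mnm1_case m : m = 0%MM \/ exists k, m = (k + U_(i0))%MM.
Proof.
have [/eqP|nz] := eqVneq (mdeg m) 0%N; first by rewrite mdeg_eq0 => /eqP; left.
right; exists (U_(i0) *+ (mdeg m).-1)%MM.
by rewrite {1}[m]mnm1E0 -{1}(prednK (n := mdeg m)) ?lt0n // mulmSr.
Qed.

Lemma mulX_inj f g : mpsX i0 * f = mpsX i0 * g -> f = g.
Proof.
by move=> fg; apply: mpsP => m; rewrite -[LHS]mcoefXMS fg mcoefXMS.
Qed.

Lemma eulerE f : euler f = mpsX i0 * mps_deriv i0 f.
Proof.
apply: mpsP => m; have [->|[k ->]] := mnm1_case m.
  by rewrite mcoefXM0 /= mdeg0.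
by rewrite mcoefXMS /= mdegD mdeg1 addn1 mdegE big_ord1.
Qed.

Lemma eulerX : euler (mpsX i0) = mpsX i0.
Proof. by apply: mpsP => m /=; case: eqP => [->|_]; rewrite ?mdeg1 ?mul0rn. Qed.

End OneVariable.

Notation Qp := {mpoly rat[4]}.

Section Rational.
Implicit Types (f g b r : mps 1 Qp) (m : 'X_{1..1}).
Local Notation x := (mpsX ord0 : mps 1 Qp).

Definition is_sqrt1 f r := r 0%MM = 1 /\ r ^+ 2 = f.

Lemma mpsC2 : mpsC (2%:R^-1 *: 1 : Qp) *+ 2 = 1 :> mps 1 Qp.
Proof.
apply: mpsP => m; rewrite mulr2n mcoefD mcoefC mcoef1; case: eqP => _; rewrite ?addr0 //.
by rewrite -scalerDl (_ : 2%:R^-1 + 2%:R^-1 = 1 :> rat) ?scale1r.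
Qed.

Lemma mpsC2M f m : (mpsC (2%:R^-1 *: 1 : Qp) * f) m = 2%:R^-1 *: f m.
Proof. by rewrite mcoefCM -scalerAl mul1r. Qed.

Lemma is_sqrt1_exists f : f 0%MM = 1 -> exists r, is_sqrt1 f r.
Proof.
move=> f1; pose cst0 (s : mps 1 Qp) : mps 1 Qp := s - mpsC (s 0%MM).
have cst00 s : (cst0 s) 0%MM = 0 by rewrite mcoefB mcoefC eqxx subrr.
pose Phi s := mpsC (2%:R^-1 *: 1) * (f - 1 - cst0 s ^+ 2).
have cPhi : causal Phi.
  move=> d s t st; apply: eqtruncM => //.
  apply: eqtruncD => //; apply: eqtruncN => m lt.
  apply/eqP; rewrite -subr_eq0 -mcoefB subr_sqr -[0]/((0 : mps 1 Qp) m).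
  apply/eqP; move: m lt; apply: mul_ord1.
    move=> m lt; rewrite /cst0 !mcoefB mcoef0 !mcoefC st //.
    case: eqP => [m0|_]; last by rewrite !subr0 subrr.
    by rewrite -m0 st // !subrr.
  by rewrite mcoefD !cst00 addr0.
have [s sE] := causal_fix cPhi.
have s0 : s 0%MM = 0.
  rewrite -sE mpsC2M !mcoefB f1 mcoef1 eqxx subrr expr2 mcoefM0 cst00.
  by rewrite mul0r subr0 scaler0.
have s00 : cst0 s = s.
  by apply: mpsP => m; rewrite mcoefB mcoefC s0; case: eqP; rewrite subr0.
exists (1 + s); split; first by rewrite mcoefD mcoef1 eqxx s0 addr0.
have : s *+ 2 = f - 1 - s ^+ 2.
  by rewrite -{1}sE /Phi s00 -mulrnAl mpsC2 mul1r.
move=> h; rewrite sqrrD expr1n mul1r h; ring.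
Qed.

Lemma is_sqrt1_uniq f r r' : is_sqrt1 f r -> is_sqrt1 f r' -> r = r'.
Proof.
move=> [r0 rf] [r'0 r'f].
pose h := mpsC (2%:R^-1 *: 1 : Qp) * (r + r').
have h0 : h 0%MM = 1.
  by rewrite mpsC2M mcoefD r0 r'0 -mulr2n -scaler_nat scalerA mulVf // scale1r.
apply/eqP; rewrite -subr_eq0 -[_ - _]mulr1 -(mpsV_mul h0) mulrA /h mulrCA.
by rewrite -subr_sqr rf r'f subrr mulr0 mul0r.
Qed.

Definition p1 : Qp := 'X_(@Ordinal 4 0 isT).
Definition p2 : Qp := 'X_(@Ordinal 4 1 isT).
Definition p3 : Qp := 'X_(@Ordinal 4 2 isT).
Definition p4 : Qp := 'X_(@Ordinal 4 3 isT).

Definition quartic : mps 1 Qp :=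
  1 + mpsC p1 * x + mpsC p2 * x ^+ 2 + mpsC p3 * x ^+ 3 + mpsC p4 * x ^+ 4.

Lemma quartic0 : quartic 0%MM = 1.
Proof.
have x0 : x 0%MM = 0 by rewrite /= eq_sym -mdeg_eq0 mdeg1.
by rewrite /quartic !exprS expr0 !mcoefD !mcoefM0 x0 !(mulr0, mul0r) mcoef1 eqxx !addr0.
Qed.

Definition calR : mps 1 Qp := sval (cid (is_sqrt1_exists quartic0)).

Lemma calRP : is_sqrt1 quartic calR.
Proof. exact: svalP (cid (is_sqrt1_exists quartic0)). Qed.

(** [b = calR (mu) / mu'] where [mu = x / b] *)
Definition is_calB b :=
  let mu := x * mpsV b in
  b 0%MM = 1 /\ b = (calR \So [tuple mu]) * mpsV (mps_deriv ord0 mu).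

Lemma euler_alg1 (S : comPzRingType) (b v d e : S) :
  b * v = 1 -> e * v + b * d = 1 -> e = b - b * (b * d).
Proof.
move=> bv h; transitivity (b * (e * v + b * d) - b * (b * d)).
  by rewrite mulrDr addrK mulrCA bv mulr1.
by rewrite h mulr1.
Qed.

Lemma euler_alg2 (S : comPzRingType) (b d w e r : S) :
  d * w = 1 -> e = b - b * (b * d) -> b = r * w -> e = b * (1 - r).
Proof.
move=> dw -> bE; have -> : b * d = r by rewrite {1}bE -mulrA [w * d]mulrC dw mulr1.
by rewrite mulrBr mulr1.
Qed.

Lemma euler_alg3 (S : comPzRingType) (b v d w e r : S) :
  b * v = 1 -> d * w = 1 -> e = b - b * (b * d) -> e = b * (1 - r) -> b = r * w.
Proof.
move=> bv dw -> h; have bb : b * (b * d) = b * r.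
  by apply: oppr_inj; apply: (addrI b); rewrite h; ring.
have -> : r = b * d.
  by rewrite -[LHS]mul1r -bv mulrAC -bb mulrAC bv mul1r.
by rewrite -mulrA dw mulr1.
Qed.

Lemma is_calB_euler b : b 0%MM = 1 ->
  is_calB b <-> euler b = b * (1 - (calR \So [tuple x * mpsV b])).
Proof.
move=> b0; have bV := mpsV_mul b0.
rewrite /is_calB /=; set mu := x * _; set D := mps_deriv _ _; set r := _ \So _.
have V0 : mpsV b 0%MM = 1.
  by have := mcoefM0 b (mpsV b); rewrite bV b0 mul1r mcoef1 eqxx.
have D0 : D 0%MM = 1.
  have -> : D 0%MM = mu (0%MM + U_(ord0))%MM by rewrite /D [LHS]/= mnm0E.
  by rewrite /mu mcoefXMS V0.
have DV := mpsV_mul D0.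
have bmu : b * mu = x by rewrite /mu mulrCA bV mulr1.
have key : euler b = b - b * (b * D).
  have := congr1 (@euler Qp) bmu; rewrite eulerM eulerX [euler mu]eulerE -/D => h.
  have : euler b * mpsV b + b * D = 1.
    apply: mulX_inj; rewrite mulr1 -[RHS]h /mu; ring.
  exact: euler_alg1 bV.
split=> [[_ bE]|h]; first by apply: (euler_alg2 DV key bE).
by split=> //; apply: (euler_alg3 bV DV key h).
Qed.

(** Inverse of [euler] on series without constant term; [is_calB b] is equivalent
    to the fixed-point equation [calB_Phi b = b]. *)
Definition calB_integ (c : mps 1 Qp) : mps 1 Qp :=
  MPS (fun m => ((mdeg m)%:R : rat)^-1 *: c m).
Definition calB_Phi b := 1 + calB_integ (b * (1 - (calR \So [tuple x * mpsV b]))).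

Lemma integ_trunc d c c' : eqtrunc d c c' -> eqtrunc d (calB_integ c) (calB_integ c').
Proof. by move=> cc m lt; rewrite /calB_integ /= cc. Qed.

Lemma rest0 b : (b * (1 - (calR \So [tuple x * mpsV b]))) 0%MM = 0.
Proof.
rewrite mcoefM0 mcoefB subst1_0 ?mcoefXM0 //.
by have [-> _] := calRP; rewrite mcoef1 eqxx subrr mulr0.
Qed.

Lemma causal_Phi : causal calB_Phi.
Proof.
move=> d b b' bb; apply: eqtruncD; [by []|apply: integ_trunc].
have R0 c : (1 - (calR \So [tuple x * mpsV c])) 0%MM = 0.
  rewrite mcoefB subst1_0 ?mcoefXM0 //.
  by have [-> _] := calRP; rewrite mcoef1 eqxx subrr.
have eqV : eqtrunc d (mpsV b) (mpsV b').
  by apply: eqtrunc_subst1; apply: eqtruncD; [by []|apply: eqtruncN].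
have eqmu : eqtrunc d.+1 (x * mpsV b) (x * mpsV b').
  move=> k; have [->|[j ->]] := mnm1_case k; first by rewrite !mcoefXM0.
  by rewrite mdegD mdeg1 addn1 ltnS !mcoefXMS; apply: eqV.
set u := 1 - _; set u' := 1 - _.
have uu : eqtrunc d.+1 u u'.
  by apply: eqtruncD; [by []|apply/eqtruncN/eqtrunc_subst1].
have -> : b * u = (b - b') * u + b' * u by rewrite mulrBl subrK.
have z : eqtrunc d.+1 ((b - b') * u) 0.
  by apply: mul_ord1; [move=> k lk; rewrite mcoefB bb // subrr|exact: R0].
move=> m lt; rewrite mcoefD z // mcoef0 add0r.
by apply: (eqtruncM (fun _ _ => erefl) uu).
Qed.

Lemma PhiP b : (is_calB b) <-> calB_Phi b = b.
Proof.
split=> [bP|bE].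
  have [b0 _] := bP; move/(is_calB_euler b0): bP => h.
  apply: mpsP => m; rewrite mcoefD mcoef1 /= -h /=.
  case: eqP => [->|/eqP nz]; first by rewrite mdeg0 scaler0 addr0 b0.
  by rewrite add0r -scaler_nat scalerA mulVf ?scale1r // Num.Theory.pnatr_eq0 mdeg_eq0.
have b0 : b 0%MM = 1 by rewrite -bE mcoefD mcoef1 eqxx /= rest0 scaler0 addr0.
apply/(is_calB_euler b0); apply: mpsP => m.
have [->|nz] := eqVneq m 0%MM; first by rewrite rest0 /= mdeg0.
rewrite [LHS]/= -{1}bE mcoefD mcoef1 (negbTE nz) add0r [LHS]/= -scaler_nat scalerA.
by rewrite mulfV ?scale1r // Num.Theory.pnatr_eq0 mdeg_eq0.
Qed.

Lemma is_calB_exists : exists b, is_calB b.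
Proof. by have [b /PhiP bP] := causal_fix causal_Phi; exists b. Qed.

Lemma is_calB_uniq b b' : is_calB b -> is_calB b' -> b = b'.
Proof. by move=> /PhiP bE /PhiP b'E; apply: causal_uniq causal_Phi bE b'E. Qed.

Definition calB : mps 1 Qp := sval (cid is_calB_exists).

Lemma calBP : is_calB calB.
Proof. exact: svalP (cid is_calB_exists). Qed.

Definition calA : mps 1 Qp :=
  calB ^+ 2 - mpsC (1 / 2%:R)%:MP * x * calB * mps_deriv ord0 calB
  + mpsC ((1 / 4%:R) *: p1) * x * calB
  - mpsC ((1 / 16%:R) *: p1 ^+ 2 - (1 / 4%:R) *: p2) * x ^+ 2.

End Rational.

Section FormalGroupLaw.
Variable R : comPzRingType.
Implicit Types (F : mps 2 R) (A B l : mps 1 R).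

Definition is_fgl F :=
  let t : mps 1 R := mpsX ord0 in
  let x1 : mps 2 R := mpsX ord0 in
  let x2 : mps 2 R := mpsX ord_max in
  let x : mps 3 R := mpsX (@Ordinal 3 0 isT) in
  let y : mps 3 R := mpsX (@Ordinal 3 1 isT) in
  let z : mps 3 R := mpsX (@Ordinal 3 2 isT) in
  [/\ F \So [tuple t; 0] = t,
      F \So [tuple 0; t] = t,
      F \So [tuple x2; x1] = F
    & F \So [tuple F \So [tuple x; y]; z] = F \So [tuple x; F \So [tuple y; z]]].

(** [F = (x^2 A(y) - y^2 A(x)) / (x B(y) - y B(x))]. The denominator is [x - y]
    times a series with constant term 1, hence not a zero divisor, and the
    quotient is expressed by multiplying it out. *)
Definition buchstaber_form F A B :=
  let x : mps 2 R := mpsX ord0 in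
  let y : mps 2 R := mpsX ord_max in
  [/\ A 0%MM = 1, B 0%MM = 1
    & F * (x * (B \So [tuple y]) - y * (B \So [tuple x]))
      = x ^+ 2 * (A \So [tuple y]) - y ^+ 2 * (A \So [tuple x])].

Definition is_buchstaber F := is_fgl F /\ exists A B, buchstaber_form F A B.

(** [B(x) = dF/dy (x, 0)], and [A] has no term in [x^2] *)
Definition normalized F A B :=
  B = mps_deriv ord_max F \So [tuple mpsX ord0; 0]
  /\ A (U_(ord0) *+ 2)%MM = 0.

Definition is_log F l :=
  let x : mps 2 R := mpsX ord0 in
  let y : mps 2 R := mpsX ord_max in
  [/\ l 0%MM = 0, l U_(ord0)%MM = 1
    & l \So [tuple F] = (l \So [tuple x]) + (l \So [tuple y])].

End FormalGroupLaw.

Definition universal_buchstaber (L : comPzRingType) (F : mps 2 L) :=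
  is_buchstaber F /\
  forall (R : comPzRingType) (G : mps 2 R), is_buchstaber G ->
    (exists f : {rmorphism L -> R}, mps_map f F = G) /\
    (forall f g : {rmorphism L -> R}, mps_map f F = G -> mps_map g F = G -> f =1 g).

(** The coefficient ring of the universal law is generated by the coefficients
    [F_ij]; its component of degree [d] is the additive group spanned by the
    products of coefficients of total degree [d], where [F_ij] has degree
    [2 (i + j - 1)]. *)
Inductive coef_degree (L : comPzRingType) (F : mps 2 L) : nat -> L -> Prop :=
| coef_degree_coef m : (0 < mdeg m)%N -> coef_degree F (2 * (mdeg m - 1)) (F m)
| coef_degree_1 : coef_degree F 0 1
| coef_degree_M d e a b :
    coef_degree F d a -> coef_degree F e b -> coef_degree F (d + e) (a * b)
| coef_degree_0 d : coef_degree F d 0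
| coef_degree_B d a b :
    coef_degree F d a -> coef_degree F d b -> coef_degree F d (a - b).

Definition biadditive (U V W : zmodType) (b : U -> V -> W) :=
  (forall u u' v, b (u + u') v = b u v + b u' v) /\
  (forall u v v', b u (v + v') = b u v + b u v').

(** [T], with [t a q] in the role of [a (x) q], is the tensor product of [L] and
    [rat] over the integers, with its ring structure. *)
Definition is_tensorQ (L T : comPzRingType) (t : L -> rat -> T) :=
  [/\ biadditive t,
      forall (M : zmodType) (b : L -> rat -> M), biadditive b ->
        (exists h : {additive T -> M}, forall a q, h (t a q) = b a q) /\
        (forall h k : {additive T -> M},
           (forall a q, h (t a q) = b a q) -> (forall a q, k (t a q) = b a q) ->
           h =1 k),
      t 1 1 = 1
    & forall a a' q q', t a q * t a' q' = t (a * a') (q * q')].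

Definition tensorQ_degree (L T : comPzRingType) (t : L -> rat -> T)
    (F : mps 2 L) (d : nat) (z : T) :=
  exists2 s : seq (L * rat),
    (forall u, u \in s -> coef_degree F d u.1) & z = \sum_(u <- s) t u.1 u.2.

(** [mnmwgt] gives weight [i] to [p_i]; the degree of [p_i] is [2 i]. *)
Definition Qp_degree (d : nat) (z : Qp) :=
  forall m, m \in msupp z -> (2 * mnmwgt m)%N = d.

Definition graded_iso (L T : comPzRingType) (t : L -> rat -> T) (F : mps 2 L)
    (phi : {rmorphism T -> Qp}) :=
  bijective phi /\ (forall d z, tensorQ_degree t F d z <-> Qp_degree d (phi z)).

(* Main.v *)
Require Import Defs.
From HB Require Import structures.
From mathcomp Require Import all_boot all_order all_algebra.
From mathcomp Require Import boolp mpoly ring.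

Set Implicit Arguments.
Unset Strict Implicit.
Unset Printing Implicit Defensive.

Import GRing.Theory.
Local Open Scope ring_scope.

(* Put [L = B / x] and [d = B d/dx], the invariant derivation.  The series [calB] is
   the solution of [(d L)^2 = L^4 + p1 L^3 + p2 L^2 + p3 L + p4].  A law [F] with
   invariant differential [dt / B(t)] is killed by [delta = B(x) d/dx - B(y) d/dy] and
   is determined by this and by [F(x, 0) = x].  So [F = num / den], where
   [num = x^2 A(y) - y^2 A(x)] and [den = x B(y) - y B(x)], amounts to
   [num * delta den = den * delta num].  This follows from the equation of [L] and its
   derivative when [A = calA]; conversely its expansion at [y = 0] forces the shape of [A]
   and an equation of order 2 for [L], whose first integral is the equation above for some
   [p1, ..., p4].  Hence the law over [Q[p1, ..., p4]] with logarithm [\int dt / calB] is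
   universal among Buchstaber laws over Q-algebras.  The grading is read off the
   substitution [p_i -> 2^i p_i], which acts on an element of weight [k] by [2^k]. *)

(** * Substitution and differentiation of power series *)

(** Two facts make the curve a complete invariant. For given [p1, ..., p4] the equation has a single
    solution with constant term 1, and the coefficient of [x ^+ i] in the equation returns [p_i] as
    a polynomial in the coefficients of [B]. The first turns parameters into laws; the second puts
    the [p_i], in the right degrees, in the algebra generated by the coefficients of the law.
    Quotients by [den] are never formed: [den] vanishes on the diagonal, so it is only shown to be
    regular, by descent on the order in [y], where it begins with [x]. Coefficient rings are mostly
    just assumed torsion free, and the equations carry factors 2 and 4 that clear denominators,
    because the tensor product is an abstract ring that merely receives a morphism from [rat]. *)

Section Monomials.
Variables (n : nat) (R : comPzRingType).
Implicit Types (f g : mps n R) (m j k : 'X_{1..n}).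

Definition mono (c : R) j : mps n R := MPS (fun m => if m == j then c else 0).

Lemma mpsCE c : mpsC c = mono c 0. Proof. exact: mpsP. Qed.

Lemma mpsXE i : mpsX i = mono 1 U_(i).
Proof. by apply: mpsP => m /=; case: eqP. Qed.

Lemma monoM c d j k : mono c j * mono d k = mono (c * d) (j + k)%MM.
Proof.
apply: mpsP => m; rewrite mcoefM /=; have [->|ne] := eqVneq m (j + k)%MM.
  have lt : (mdeg j < (mdeg (j + k)%MM).+1)%N by rewrite mdegD ltnS leq_addr.
  have jk : (j + k - j)%MM = k by rewrite addmC addmK.
  rewrite (bigD1 (BMultinom lt)) ?lem_addr //= jk !eqxx big1 ?addr0 //.
  by move=> a /andP[_]; rewrite bmeqP /= => /negbTE ->; rewrite mul0r.
apply: big1 => a le; case: eqP => [aj|_]; last by rewrite mul0r.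
case: eqP => [mk|_]; last by rewrite mulr0.
by case/eqP: ne; rewrite -aj -mk addmC submK.
Qed.

Lemma mpsXnE (i : 'I_n) e : mpsX i ^+ e = mono 1 (U_(i) *+ e)%MM.
Proof.
elim: e => [|e IH]; first by rewrite expr0 mulm0n -mpsCE.
by rewrite exprS IH mpsXE monoM mul1r mulmS.
Qed.

Lemma prod_mpsX m : \prod_(i < n) mpsX i ^+ m i = mono 1 m.
Proof.
rewrite (eq_bigr _ (fun i _ => mpsXnE i (m i))) [in RHS](multinomUE_id m).
elim/big_rec2: _ => [|i y1 y2 _ ->]; first by rewrite -mpsCE.
by rewrite monoM mul1r.
Qed.

Lemma mono_prod c m : mono c m = mpsC c * \prod_(i < n) mpsX i ^+ m i.
Proof. by rewrite prod_mpsX mpsCE monoM mulr1 add0m. Qed.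

Lemma eqtrunc_mono d f :
  eqtrunc d f (\sum_(j : 'X_{1..n < d}) mono (f j) j).
Proof.
move=> m lt; rewrite mcoef_sum (bigD1 (BMultinom lt)) //= eqxx big1 ?addr0 //.
by move=> j; rewrite bmeqP /= eq_sym => /negbTE ->.
Qed.

(** The last premise is closure under limits for truncation. An identity between operations that
    respect sums, products and truncation then need only be checked on constants and variables. *)
Lemma mps_ind (P : mps n R -> Prop) :
  (forall c, P (mpsC c)) -> (forall i, P (mpsX i)) ->
  (forall f g, P f -> P g -> P (f + g)) -> (forall f g, P f -> P g -> P (f * g)) ->
  (forall f, (forall d, exists2 g, eqtrunc d f g & P g) -> P f) -> forall f, P f.
Proof.
move=> PC PX PD PM Plim f; apply: Plim => d.
exists (\sum_(j : 'X_{1..n < d}) mono (f j) j); first exact: eqtrunc_mono.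
have P0 : P 0.
  by have -> : 0 = mpsC 0 :> mps n R by apply: mpsP => m; rewrite mcoefC if_same.
elim/big_rec: _ => // j g _ Pg; apply: PD Pg; rewrite mono_prod.
apply: (PM) => //; elim/big_rec: _ => [|i h _ Ph]; first exact: (PC 1).
by apply: (PM) Ph; elim: (bmnm j i) => [|e IH]; [exact: (PC 1) | rewrite exprS; exact: PM].
Qed.

Lemma mpsCD c d : mpsC (c + d) = mpsC c + mpsC d :> mps n R.
Proof. by apply: mpsP => m; rewrite mcoefD !mcoefC; case: eqP; rewrite ?addr0. Qed.
Lemma mpsCN c : mpsC (- c) = - mpsC c :> mps n R.
Proof. by apply: mpsP => m; rewrite mcoefN !mcoefC; case: eqP; rewrite ?oppr0. Qed.
Lemma mpsC_mul c d : mpsC (c * d) = mpsC c * mpsC d :> mps n R.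
Proof. by rewrite !mpsCE monoM add0m. Qed.
Lemma mpsC0 : mpsC 0 = 0 :> mps n R.
Proof. by apply: mpsP => m; rewrite mcoefC if_same. Qed.
Lemma mpsC1 : mpsC 1 = 1 :> mps n R. Proof. by []. Qed.

Lemma mcoefX0 i : (mpsX i : mps n R) 0%MM = 0.
Proof. by rewrite /= eq_sym -mdeg_eq0 mdeg1. Qed.

End Monomials.

Section Subst.
Variables (k n : nat) (R : comPzRingType).
Implicit Types (f g : mps k R) (u : k.-tuple (mps n R)).

Definition null_tuple u := forall i, (tnth u i) 0%MM = 0.

Lemma mps_prod_ord u (j : 'X_{1..k}) : null_tuple u ->
  eqtrunc (mdeg j) (\prod_(i < k) tnth u i ^+ j i) 0.
Proof.
move=> u0; rewrite mdegE; elim/big_rec2: _ => // i d h _ IH.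
by apply: mul_ord => //; apply: exp_ord.
Qed.

Lemma mps_substE f u m : (f \So u) m =
  \sum_(j : 'X_{1..k < (mdeg m).+1}) f j * (\prod_(i < k) tnth u i ^+ j i) m.
Proof. by rewrite mps_subst.unlock. Qed.

Lemma eqtrunc_subst d f g u : eqtrunc d f g -> eqtrunc d (f \So u) (g \So u).
Proof.
move=> fg m lt; rewrite !mps_substE; apply: eq_bigr => j _; rewrite fg //.
by apply: leq_trans lt; apply: bmdeg.
Qed.

Lemma mps_substD f g u : (f + g) \So u = (f \So u) + (g \So u).
Proof.
apply: mpsP => m; rewrite mcoefD !mps_substE -big_split /=.
by apply: eq_bigr => j _; rewrite mulrDl.
Qed.

Lemma mps_substN f u : (- f) \So u = - (f \So u).
Proof.
apply: mpsP => m; rewrite mcoefN !mps_substE -sumrN.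
by apply: eq_bigr => j _; rewrite mcoefN mulNr.
Qed.

Lemma mps_substB f g u : (f - g) \So u = (f \So u) - (g \So u).
Proof. by rewrite mps_substD mps_substN. Qed.

Lemma mps_subst0 u : (0 : mps k R) \So u = 0.
Proof. by rewrite -[X in X \So u](subrr 0) mps_substB subrr. Qed.

Lemma mps_subst_sum I (r : seq I) (P : pred I) (G : I -> mps k R) u :
  (\sum_(i <- r | P i) G i) \So u = \sum_(i <- r | P i) (G i \So u).
Proof. by elim/big_rec2: _ => [|i x y _ <-]; rewrite ?mps_subst0 ?mps_substD. Qed.

Lemma mps_subst_mono c j u : null_tuple u ->
  mono c j \So u = mpsC c * \prod_(i < k) tnth u i ^+ j i.
Proof.
move=> u0; apply: mpsP => m; rewrite mps_substE mcoefCM /=.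
have [lt|ge] := ltnP (mdeg j) (mdeg m).+1.
  rewrite (bigD1 (BMultinom lt)) //= eqxx [X in _ + X]big1 ?addr0 // => a.
  by rewrite bmeqP /= => /negbTE ->; rewrite mul0r.
(* A monomial of degree above [mdeg m] is missing from the truncated sum, and its image has order at
   least [mdeg j], hence no coefficient at [m]. *)
rewrite (mps_prod_ord u0 ge) mulr0 big1 // => a _; case: eqP => [aj|_]; last by rewrite mul0r.
by have := bmdeg a; rewrite aj ltnNge ge.
Qed.

Lemma mps_substC c u : null_tuple u -> mpsC c \So u = mpsC c.
Proof.
move=> u0; rewrite mpsCE mps_subst_mono // big1 ?mulr1 // => i _.
by rewrite mnm0E expr0.
Qed.

Lemma mps_substX i u : null_tuple u -> mpsX i \So u = tnth u i.
Proof.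
move=> u0; rewrite mpsXE mps_subst_mono // mpsC1 mul1r (bigD1 i) //= mnm1E eqxx expr1.
by rewrite big1 ?mulr1 // => l ne; rewrite mnm1E eq_sym (negbTE ne) expr0.
Qed.

(** Below degree [d] only finitely many monomials of the factors matter, and on monomials the
    identity is the law of exponents. *)
Lemma mps_substM f g u : null_tuple u -> (f * g) \So u = (f \So u) * (g \So u).
Proof.
move=> u0; apply: eqtrunc_eq => d.
pose tr (h : mps k R) : mps k R := \sum_(j : 'X_{1..k < d}) mono (h j) j.
have trE h : eqtrunc d (h \So u) (tr h \So u).
  by apply: eqtrunc_subst; apply: eqtrunc_mono.
have fgE : eqtrunc d ((f * g) \So u) ((tr f * tr g) \So u).
  by apply: eqtrunc_subst; apply: eqtruncM; apply: eqtrunc_mono.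
move=> m lt; rewrite fgE // (eqtruncM (trE f) (trE g)) //; congr (mcoef _ m).
rewrite /tr !mps_subst_sum mulr_suml mulr_suml mps_subst_sum.
apply: eq_bigr => i _; rewrite !mulr_sumr mps_subst_sum; apply: eq_bigr => j _.
rewrite monoM !mps_subst_mono // mpsC_mul mulrACA -big_split /=; congr (_ * _).
by apply: eq_bigr => l _; rewrite mnmDE exprD.
Qed.

Lemma mps_subst1 u : null_tuple u -> (1 : mps k R) \So u = 1.
Proof. exact: mps_substC. Qed.

Lemma mps_substXn f u e : null_tuple u -> (f ^+ e) \So u = (f \So u) ^+ e.
Proof. by move=> u0; elim: e => [|e IH]; rewrite ?mps_subst1 // !exprS mps_substM // IH. Qed.

Lemma mps_subst_coef0 f u : null_tuple u -> (f \So u) 0%MM = f 0%MM.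
Proof.
move=> u0; rewrite (eqtrunc_subst u (g := mpsC (f 0%MM)) (d := 1)) ?mdeg0 //.
  by rewrite mps_substC //= eqxx.
by move=> m; rewrite ltnS leqn0 mdeg_eq0 => /eqP ->; rewrite mcoefC eqxx.
Qed.

End Subst.

Lemma mps_substA l k n (R : comPzRingType) (f : mps l R) (u : l.-tuple (mps k R))
    (v : k.-tuple (mps n R)) : null_tuple u -> null_tuple v ->
  (f \So u) \So v = f \So [tuple tnth u i \So v | i < l].
Proof.
move=> u0 v0; have w0 : null_tuple [tuple tnth u i \So v | i < l].
  by move=> i; rewrite tnth_mktuple mps_subst_coef0.
elim/mps_ind: f => [c|i|f g IHf IHg|f g IHf IHg|f IH].
- by rewrite !mps_substC.
- by rewrite !mps_substX // tnth_mktuple.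
- by rewrite !mps_substD IHf IHg.
- by rewrite !mps_substM // IHf IHg.
apply: eqtrunc_eq => d m lt; have [g fg gE] := IH d.
by rewrite !(eqtrunc_subst _ (eqtrunc_subst _ fg)) // gE -(eqtrunc_subst _ fg).
Qed.

Lemma mps_subst_id n (R : comPzRingType) (f : mps n R) : f \So [tuple mpsX i | i < n] = f.
Proof.
have X0 : null_tuple [tuple (mpsX i : mps n R) | i < n] by move=> i; rewrite tnth_mktuple mcoefX0.
elim/mps_ind: f => [c|i|f g IHf IHg|f g IHf IHg|f IH].
- by rewrite mps_substC.
- by rewrite mps_substX // tnth_mktuple.
- by rewrite mps_substD IHf IHg.
- by rewrite mps_substM // IHf IHg.
apply: eqtrunc_eq => d m lt; have [g fg gE] := IH d.
by rewrite (eqtrunc_subst _ fg) // gE fg.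
Qed.

Section Deriv.
Variables (n : nat) (R : comPzRingType).
Implicit Types (f g : mps n R) (i : 'I_n).

Lemma eqtrunc_deriv i d f g :
  eqtrunc d.+1 f g -> eqtrunc d (mps_deriv i f) (mps_deriv i g).
Proof. by move=> fg m lt /=; rewrite fg // mdegD mdeg1 addn1. Qed.

Lemma mps_derivD i f g : mps_deriv i (f + g) = mps_deriv i f + mps_deriv i g.
Proof. by apply: mpsP => m; rewrite mcoefD /= mulrnDl. Qed.
Lemma mps_derivN i f : mps_deriv i (- f) = - mps_deriv i f.
Proof. by apply: mpsP => m; rewrite mcoefN /= mulNrn. Qed.

Lemma mps_derivC i (c : R) : mps_deriv i (mpsC c) = 0.
Proof.
apply: mpsP => m /=; case: eqP => [/(congr1 (@mdeg n))/eqP|_]; last by rewrite mul0rn.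
by rewrite mdegD mdeg1 mdeg0 addn1.
Qed.
Lemma mps_deriv0 i : mps_deriv i (0 : mps n R) = 0.
Proof. by apply: mpsP => m; rewrite /= mul0rn. Qed.
Lemma mps_deriv1 i : mps_deriv i (1 : mps n R) = 0.
Proof. exact: mps_derivC. Qed.

Lemma mps_deriv_nat i k : mps_deriv i (k%:R : mps n R) = 0.
Proof. by elim: k => [|k IH]; rewrite ?mps_deriv0 // -natr1 mps_derivD IH mps_deriv1 addr0. Qed.

(** When [j i = 0] the truncated exponent [j - U_(i)] is a default value, harmless because the
    coefficient is [c *+ 0]. *)
Lemma mps_deriv_mono i (c : R) j : mps_deriv i (mono c j) = mono (c *+ j i) (j - U_(i))%MM.
Proof.
apply: mpsP => m /=; have [ji|ji] := posnP (j i).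
  rewrite ji mulr0n if_same; case: eqP => [mj|_]; last by rewrite mul0rn.
  by move: ji; rewrite -mj mnmDE mnm1E eqxx addn1.
have le : (U_(i) <= j)%MM by rewrite lep1mP -lt0n.
have -> : (m + U_(i) == j)%MM = (m == j - U_(i))%MM.
  by rewrite -{1}(submK le) eqm_add2r.
case: eqP => [->|_]; last by rewrite mul0rn.
by rewrite mnmBE mnm1E eqxx subn1 prednK.
Qed.

Lemma mps_derivX i l : mps_deriv i (mpsX l : mps n R) = (i == l)%:R.
Proof.
rewrite mpsXE mps_deriv_mono mnm1E [l == i]eq_sym; case: eqP => [->|_].
  by rewrite -[X in (X - _)%MM]add0m addmK -mpsCE.
by rewrite mulr0n; apply: mpsP => m; rewrite /= if_same.
Qed.

Lemma mps_deriv_sum I (r : seq I) (P : pred I) (G : I -> mps n R) i :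
  mps_deriv i (\sum_(l <- r | P l) G l) = \sum_(l <- r | P l) mps_deriv i (G l).
Proof. by elim/big_rec2: _ => [|l x y _ <-]; rewrite ?mps_deriv0 ?mps_derivD. Qed.

Lemma mps_derivM i f g : mps_deriv i (f * g) = mps_deriv i f * g + f * mps_deriv i g.
Proof.
apply: eqtrunc_eq => d.
(* Differentiation costs one degree, so the factors are truncated at [d.+1] to compare both sides
   below [d]. *)
pose tr (h : mps n R) : mps n R := \sum_(j : 'X_{1..n < d.+1}) mono (h j) j.
have trE h : eqtrunc d.+1 h (tr h) by apply: eqtrunc_mono.
have trD h := eqtrunc_deriv i (trE h).
have tr' h := eqtruncW (leqnSn d) (trE h).
move=> m lt; rewrite (eqtrunc_deriv i (eqtruncM (trE f) (trE g))) //.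
rewrite (eqtruncD (eqtruncM (trD f) (tr' g)) (eqtruncM (tr' f) (trD g))) //; congr (mcoef _ m).
rewrite /tr !mps_deriv_sum !mulr_suml mps_deriv_sum -big_split /=; apply: eq_bigr => j _.
rewrite !mulr_sumr mps_deriv_sum -big_split /=; apply: eq_bigr => l _.
move: (f j) (g l) => c c'; case: j l => j _ [l _] /=.
rewrite monoM !mps_deriv_mono !monoM mnmDE mulrnDr -mulrnAl -mulrnAr.
(* Moves the truncated subtraction out of a sum of exponents; when the variable [i] does not occur
   in [h], the coefficient [a] is zero. *)
have shift a (h h' : 'X_{1..n}) : (h i = 0%N -> a = 0) ->
    mono a (h - U_(i) + h')%MM = mono a (h + h' - U_(i))%MM.
  move=> a0; have [/a0 ->|hi] := posnP (h i); first by apply: mpsP => q; rewrite /= !if_same.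
  by rewrite addmC addmBA ?lep1mP -?lt0n // addmC.
rewrite shift => [|->]; last by rewrite mulr0n mul0r.
rewrite [(j + (l - _))%MM]addmC shift => [|->]; last by rewrite mulr0n mulr0.
rewrite [(l + j)%MM]addmC.
by apply: mpsP => q; rewrite mcoefD /=; case: eqP; rewrite ?addr0.
Qed.

End Deriv.

Lemma mps_deriv_subst k n (R : comPzRingType) (f : mps k R) (u : k.-tuple (mps n R)) i :
  null_tuple u ->
  mps_deriv i (f \So u) = \sum_(l < k) (mps_deriv l f \So u) * mps_deriv i (tnth u l).
Proof.
move=> u0; elim/mps_ind: f => [c|j|f g IHf IHg|f g IHf IHg|f IH].
- by rewrite mps_substC // mps_derivC big1 // => l _; rewrite mps_derivC mps_subst0 mul0r.
- rewrite mps_substX // (bigD1 j) //= mps_derivX eqxx mps_subst1 // mul1r big1 ?addr0 // => l ne.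
  by rewrite mps_derivX (negbTE ne) mps_subst0 mul0r.
- rewrite mps_substD mps_derivD IHf IHg -big_split /=; apply: eq_bigr => l _.
  by rewrite mps_derivD mps_substD mulrDl.
- rewrite mps_substM // mps_derivM IHf IHg mulr_suml mulr_sumr -big_split /=.
  by apply: eq_bigr => l _; rewrite mps_derivM mps_substD !mps_substM // mulrDl mulrA;
     congr (_ + _); ring.
apply: eqtrunc_eq => d m lt; have [g fg gE] := IH d.+1.
rewrite (eqtrunc_deriv i (eqtrunc_subst u fg)) // gE !mcoef_sum; apply: eq_bigr => l _.
apply/esym/(eqtruncM (d := d)) => //; apply: eqtrunc_subst; exact: eqtrunc_deriv.
Qed.

Section Map.
Variables (n : nat) (R S : comPzRingType) (phi : {rmorphism R -> S}).
Implicit Types (f g : mps n R).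

Lemma mps_mapD f g : mps_map phi (f + g) = mps_map phi f + mps_map phi g.
Proof. by apply: mpsP => m; rewrite mcoefD /= rmorphD. Qed.
Lemma mps_mapN f : mps_map phi (- f) = - mps_map phi f.
Proof. by apply: mpsP => m; rewrite mcoefN /= rmorphN. Qed.
Lemma mps_mapM f g : mps_map phi (f * g) = mps_map phi f * mps_map phi g.
Proof.
apply: mpsP => m; rewrite mcoefM /= mcoefM rmorph_sum; apply: eq_bigr => k _ /=.
by rewrite rmorphM.
Qed.
Lemma mps_mapC c : mps_map phi (mpsC c) = mpsC (phi c) :> mps n S.
Proof. by apply: mpsP => m /=; case: eqP; rewrite ?rmorph0. Qed.
Lemma mps_map0 : mps_map phi 0 = 0 :> mps n S.
Proof. by apply: mpsP => m; rewrite /= rmorph0. Qed.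
Lemma mps_map1 : mps_map phi 1 = 1 :> mps n S.
Proof. by rewrite -mpsC1 mps_mapC rmorph1. Qed.
Lemma mps_mapX i : mps_map phi (mpsX i) = mpsX i :> mps n S.
Proof. by apply: mpsP => m /=; rewrite rmorph_nat. Qed.
Lemma mps_mapXn f e : mps_map phi (f ^+ e) = mps_map phi f ^+ e.
Proof. by elim: e => [|e IH]; rewrite ?mps_map1 // !exprS mps_mapM IH. Qed.
Lemma mps_map_deriv i f : mps_map phi (mps_deriv i f) = mps_deriv i (mps_map phi f).
Proof. by apply: mpsP => m; rewrite /= rmorphMn. Qed.
End Map.

Lemma mps_map_subst k n (R S : comPzRingType) (phi : {rmorphism R -> S}) (f : mps k R)
    (u : k.-tuple (mps n R)) :
  mps_map phi (f \So u) = mps_map phi f \So [tuple mps_map phi (tnth u i) | i < k].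
Proof.
apply: mpsP => m; rewrite /= !mps_substE rmorph_sum; apply: eq_bigr => j _ /=.
rewrite rmorphM; congr (_ * _); rewrite -[LHS]/(mps_map phi _ m); congr (mcoef _ m).
elim/big_rec2: _ => [|i x y _ <-]; first by rewrite mps_map1.
by rewrite mps_mapM mps_mapXn tnth_mktuple.
Qed.

Section FewVariables.
Variables (R : comPzRingType).
Implicit Types (n : nat).

Lemma null_tuple1 n (g : mps n R) : g 0%MM = 0 -> null_tuple [tuple g].
Proof. by move=> g0 i; rewrite ord1. Qed.

Lemma null_tuple2 n (f g : mps n R) :
  f 0%MM = 0 -> g 0%MM = 0 -> null_tuple [tuple f; g].
Proof. by move=> f0 g0; case; case=> [|[|]]. Qed.

Lemma mps_subst_comp1 k n (f : mps 1 R) (g : mps k R) (v : k.-tuple (mps n R)) :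
  g 0%MM = 0 -> null_tuple v -> (f \So [tuple g]) \So v = f \So [tuple g \So v].
Proof.
move=> g0 v0; rewrite mps_substA //; last exact: null_tuple1.
by congr (f \So _); apply: eq_from_tnth => i; rewrite tnth_mktuple !ord1.
Qed.

Lemma mps_subst_comp2 k n (f : mps 2 R) (g h : mps k R) (v : k.-tuple (mps n R)) :
  g 0%MM = 0 -> h 0%MM = 0 -> null_tuple v ->
  (f \So [tuple g; h]) \So v = f \So [tuple g \So v; h \So v].
Proof.
move=> g0 h0 v0; rewrite mps_substA //; last exact: null_tuple2.
by congr (f \So _); apply: eq_from_tnth; case; case=> [|[|]] // lt; rewrite tnth_mktuple.
Qed.

Lemma mps_deriv_subst1 n (f : mps 1 R) (g : mps n R) i : g 0%MM = 0 ->
  mps_deriv i (f \So [tuple g]) = (mps_deriv ord0 f \So [tuple g]) * mps_deriv i g.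
Proof. by move=> g0; rewrite mps_deriv_subst ?big_ord1 //; apply: null_tuple1. Qed.

Lemma mps_deriv_subst2 n (f : mps 2 R) (g h : mps n R) i : g 0%MM = 0 -> h 0%MM = 0 ->
  mps_deriv i (f \So [tuple g; h]) =
    (mps_deriv ord0 f \So [tuple g; h]) * mps_deriv i g
    + (mps_deriv ord_max f \So [tuple g; h]) * mps_deriv i h.
Proof.
move=> g0 h0; rewrite mps_deriv_subst; last exact: null_tuple2.
by rewrite big_ord_recl big_ord1 (_ : lift _ _ = ord_max) //; apply: val_inj.
Qed.

Lemma mps_subst_X1 n (g : mps n R) : g 0%MM = 0 -> mpsX ord0 \So [tuple g] = g.
Proof. by move=> g0; rewrite mps_substX //; apply: null_tuple1. Qed.
Lemma mps_subst_Xl n (g h : mps n R) :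
  g 0%MM = 0 -> h 0%MM = 0 -> mpsX ord0 \So [tuple g; h] = g.
Proof. by move=> g0 h0; rewrite mps_substX //; apply: null_tuple2. Qed.
Lemma mps_subst_Xr n (g h : mps n R) :
  g 0%MM = 0 -> h 0%MM = 0 -> mpsX ord_max \So [tuple g; h] = h.
Proof. by move=> g0 h0; rewrite mps_substX //; apply: null_tuple2. Qed.

Lemma mps_subst_id1 (f : mps 1 R) : f \So [tuple mpsX ord0] = f.
Proof.
rewrite -[RHS]mps_subst_id; congr (f \So _); apply: eq_from_tnth => i.
by rewrite tnth_mktuple !ord1.
Qed.

Lemma mps_subst_id2 (f : mps 2 R) : f \So [tuple mpsX ord0; mpsX ord_max] = f.
Proof.
rewrite -[RHS]mps_subst_id; congr (f \So _); apply: eq_from_tnth; case; case=> [|[|]] // lt;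
  by rewrite tnth_mktuple; congr mpsX; apply: val_inj.
Qed.

Lemma mps_subst1_at0 n (f : mps 1 R) : f \So [tuple (0 : mps n R)] = mpsC (f 0%MM).
Proof.
have u0 : null_tuple [tuple (0 : mps n R)] by apply: null_tuple1.
elim/mps_ind: f => [c|i|f g IHf IHg|f g IHf IHg|f IH].
- by rewrite mps_substC //= eqxx.
- by rewrite mps_substX // mcoefX0 mpsC0 ord1.
- by rewrite mps_substD IHf IHg mcoefD mpsCD.
- by rewrite mps_substM // IHf IHg mcoefM0 mpsC_mul.
apply: eqtrunc_eq => d m lt; have [g fg gE] := IH d.+1.
by rewrite (eqtrunc_subst _ fg) ?ltnS 1?ltnW // gE fg ?mdeg0.
Qed.

Lemma mps_mulX_coef n (i : 'I_n) (f : mps n R) m : (mpsX i * f) (m + U_(i))%MM = f m.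
Proof.
have lt : (mdeg (U_(i) : 'X_{1..n}) < (mdeg (m + U_(i))%MM).+1)%N.
  by rewrite mdegD ltnS leq_addl.
rewrite mcoefM (bigD1 (BMultinom lt)) ?lem_addl //=.
rewrite eqxx mul1r addmK big1 ?addr0 // => k /andP[_].
by rewrite bmeqP /= => /negbTE ->; rewrite mul0r.
Qed.

Lemma mps_mulX_inj n (i : 'I_n) (f g : mps n R) : mpsX i * f = mpsX i * g -> f = g.
Proof. by move=> fg; apply: mpsP => m; rewrite -(mps_mulX_coef i) fg mps_mulX_coef. Qed.

Lemma mps_mulI n (f g h : mps n R) : f 0%MM = 1 -> f * g = f * h -> g = h.
Proof.
move=> f1 e; rewrite -[g]mul1r -[h]mul1r -(mpsV_mul f1).
by rewrite ![f * _]mulrC -!mulrA e.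
Qed.

Lemma mcoefXS (f : mps 1 R) e :
  (mpsX ord0 * f) (U_(ord0) *+ e.+1)%MM = f (U_(ord0) *+ e)%MM.
Proof. by rewrite mulmSr mps_mulX_coef. Qed.

Lemma mcoefX0M n (i : 'I_n) (f : mps n R) : (mpsX i * f) 0%MM = 0.
Proof. by rewrite mcoefM0 mcoefX0 mul0r. Qed.

End FewVariables.

Lemma mps_map_subst1 n (R S : comPzRingType) (phi : {rmorphism R -> S}) (f : mps 1 R)
    (g : mps n R) :
  mps_map phi (f \So [tuple g]) = mps_map phi f \So [tuple mps_map phi g].
Proof.
rewrite mps_map_subst; congr (_ \So _); apply: eq_from_tnth => i.
by rewrite tnth_mktuple !ord1.
Qed.

Lemma mps_map_subst2 n (R S : comPzRingType) (phi : {rmorphism R -> S}) (f : mps 2 R)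
    (g h : mps n R) :
  mps_map phi (f \So [tuple g; h]) = mps_map phi f \So [tuple mps_map phi g; mps_map phi h].
Proof.
rewrite mps_map_subst; congr (_ \So _); apply: eq_from_tnth; case; case=> [|[|]] // lt;
by rewrite tnth_mktuple.
Qed.

Lemma mcoefMn n (R : comPzRingType) (f : mps n R) e m : (f *+ e) m = f m *+ e.
Proof. by elim: e => [|e IH]; rewrite ?mulr0n // !mulrS mcoefD IH. Qed.

Lemma natr_mpsC n (R : comPzRingType) k (c : R) :
  k%:R * mpsC c = mpsC (k%:R * c) :> mps n R.
Proof. by apply: mpsP => m; rewrite !mulr_natl mcoefMn /=; case: eqP; rewrite ?mul0rn. Qed.

Lemma mps_natE n (R : comPzRingType) k : k%:R = mpsC k%:R :> mps n R.
Proof. by rewrite -[LHS]mulr1 -mpsC1 natr_mpsC mulr1. Qed.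

Definition torsion_free (R : zmodType) := forall (a : R) n, a *+ n.+1 = 0 -> a = 0.

Lemma torsion_free_mps n (R : comPzRingType) :
  torsion_free R -> torsion_free (mps n R).
Proof.
move=> tf f e fe; apply: mpsP => m; apply: (tf _ e).
by rewrite -mcoefMn fe.
Qed.

Lemma torsion_freeM (R : comPzRingType) (a : R) n :
  torsion_free R -> n.+1%:R * a = 0 -> a = 0.
Proof. by move=> tf; rewrite mulr_natl => /tf. Qed.

(** * Restriction of a series in [x, y] to [y = 0] *)

Section AtY0.
Variables (R : comPzRingType).
Implicit Types (f : mps 2 R).
Local Notation x := (mpsX ord0 : mps 1 R).

Definition aty0 f : mps 1 R := f \So [tuple mpsX ord0; 0].

Lemma null_aty0 : null_tuple [tuple x; 0].
Proof. by apply: null_tuple2; rewrite ?mcoefX0. Qed.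

Lemma aty0E f m : aty0 f m = f (U_(ord0) *+ mdeg m)%MM.
Proof.
have dE : mdeg (U_(ord0) *+ mdeg m : 'X_{1..2})%MM = mdeg m by rewrite mdegMn mdeg1 mul1n.
have lt : (mdeg (U_(ord0) *+ mdeg m : 'X_{1..2})%MM < (mdeg m).+1)%N by rewrite dE.
rewrite /aty0 mps_substE (bigD1 (BMultinom lt)) //= big_ord_recl big_ord1 /=.
rewrite !mulmnE !mnm1E /= mul1n mul0n expr0 mulr1 mpsXnE /= -mnm1E0 eqxx mulr1.
rewrite [X in _ + X]big1 ?addr0 // => j; rewrite bmeqP /= => ne.
rewrite big_ord_recl big_ord1 /= mpsXnE.
have -> : tnth [tuple x; 0] (lift ord0 ord0) = 0 by [].
rewrite expr0n; case: eqP => [j1|_]; last by rewrite mulr0 mcoef0 mulr0.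
rewrite mulr1 /=; case: eqP => [mj|_]; last by rewrite mulr0.
have dm : mdeg m = bmnm j ord0 by rewrite [in LHS]mj mdegMn mdeg1 mul1n.
case/eqP: ne; apply/mnmP; case; case=> [|[|]] // lt';
  rewrite mulmnE mnm1E [X in (_ * X)%N]dm /= ?mul1n ?mul0n.
  by congr (bmnm j _); apply: val_inj.
by rewrite -[RHS]j1; congr (bmnm j _); apply: val_inj.
Qed.

Lemma aty0M f g : aty0 (f * g) = aty0 f * aty0 g.
Proof. exact: mps_substM null_aty0. Qed.
Lemma aty0D f g : aty0 (f + g) = aty0 f + aty0 g.
Proof. exact: mps_substD. Qed.
Lemma aty0N f : aty0 (- f) = - aty0 f.
Proof. exact: mps_substN. Qed.
Lemma aty0C c : aty0 (mpsC c) = mpsC c.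
Proof. exact: mps_substC null_aty0. Qed.
Lemma aty0_1 : aty0 1 = 1.
Proof. exact: aty0C. Qed.
Lemma aty0Xn f e : aty0 (f ^+ e) = aty0 f ^+ e.
Proof. exact: mps_substXn null_aty0. Qed.
Lemma aty0_x : aty0 (mpsX ord0) = x.
Proof. exact: mps_substX null_aty0. Qed.
Lemma aty0_y : aty0 (mpsX ord_max) = 0.
Proof. exact: mps_substX null_aty0. Qed.

Lemma mps_deriv_aty0_inj f : torsion_free R ->
  mps_deriv ord_max f = 0 -> aty0 f = 0 -> f = 0.
Proof.
move=> tf df f0; apply: mpsP => m.
have [m1|m1] := posnP (m ord_max); last first.
  have mE : m = (m - U_(ord_max) + U_(ord_max))%MM by rewrite submK // lep1mP -lt0n.
  rewrite mE; apply: (tf _ ((m - U_(ord_max))%MM ord_max)).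
  by rewrite -[LHS]/(mps_deriv ord_max f (m - U_(ord_max))%MM) df.
have := congr1 (fun g : mps 1 R => g (U_(ord0) *+ m ord0)%MM) f0.
rewrite aty0E mdegMn mdeg1 mul1n /= => <-; congr (f _); apply/mnmP.
case; case=> [|[|]] // lt; rewrite mulmnE mnm1E /= ?mul1n ?mul0n.
  by congr (m _); apply: val_inj.
by rewrite -[RHS]m1; congr (m _); apply: val_inj.
Qed.

End AtY0.

(** * The differential equation of [B] *)

Section Curve.
Variable R : comPzRingType.
Implicit Types (b : mps 1 R).
Local Notation x := (mpsX ord0 : mps 1 R).

(* [(d L)^2 = L^4 + p1 L^3 + p2 L^2 + p3 L + p4], multiplied by [x^4] *)
Definition on_curve (p1 p2 p3 p4 : R) b :=
  b 0%MM = 1 /\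
  b ^+ 2 * (b - euler b) ^+ 2 =
    b ^+ 4 + mpsC p1 * x * b ^+ 3 + mpsC p2 * x ^+ 2 * b ^+ 2
    + mpsC p3 * x ^+ 3 * b + mpsC p4 * x ^+ 4.

Lemma eulerB b b' : euler (b - b') = euler b - euler b'.
Proof. by apply: mpsP => m; rewrite mcoefB /= mulrnBl. Qed.

Lemma euler0 b : euler b 0%MM = 0.
Proof. by rewrite /= mdeg0. Qed.

Lemma mcoefM_lead n d (f g : mps n R) m :
  eqtrunc d f 0 -> mdeg m = d -> (f * g) m = f m * g 0%MM.
Proof.
move=> f0 dm; have -> : f * g = f * (g - mpsC (g 0%MM)) + mpsC (g 0%MM) * f by ring.
rewrite mcoefD mcoefCM (mul_ord1 f0) ?dm ?mcoef0 ?add0r 1?mulrC //.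
by rewrite mcoefB mcoefC eqxx subrr.
Qed.

(** Subtracting the two equations gives [key], in which [g1] and [g2] have no constant term. In the
    lowest degree [d] of [D = b - b'] it therefore reads [2 d D_d = 0]; degree 0 is settled by the
    common constant term 1. *)
Lemma on_curve_uniq (p1 p2 p3 p4 : R) b b' : torsion_free R ->
  on_curve p1 p2 p3 p4 b -> on_curve p1 p2 p3 p4 b' -> b = b'.
Proof.
move=> tf [b0 bE] [b'0 b'E]; apply/eqP; rewrite -subr_eq0; apply/eqP.
set D := b - b'; set e := euler b; set e' := euler b'.
have eD : euler D = e - e' by rewrite eulerB.
pose g1 := - 2 * (b ^+ 2 + b * b' + b' ^+ 2) * e + (b + b') * e ^+ 2
  - x * (mpsC p1 * (b ^+ 2 + b * b' + b' ^+ 2) + mpsC p2 * x * (b + b')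
         + mpsC p3 * x ^+ 2).
pose g2 := b' ^+ 2 * (e + e').
have key : 2 * (euler D * b' ^+ 3) = D * g1 + euler D * g2.
  move: bE b'E; rewrite -/e -/e' => bE b'E.
  (* The difference of the left sides of the two equations is added to both members, and only the
     copy on the right is rewritten; what remains is a polynomial identity. *)
  apply: (addIr (b ^+ 2 * (b - e) ^+ 2 - b' ^+ 2 * (b' - e') ^+ 2)).
  rewrite {2}bE {2}b'E /g1 /g2 eD /D; ring.
have c0 (f g : mps 1 R) : f 0%MM = 0 -> (f * g) 0%MM = 0.
  by move=> f0; rewrite mcoefM0 f0 mul0r.
have e0 : e 0%MM = 0 by apply: euler0.
have e'0 : e' 0%MM = 0 by apply: euler0.
have g10 : g1 0%MM = 0.
  have -> : g1 = e * (- 2 * (b ^+ 2 + b * b' + b' ^+ 2) + (b + b') * e)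
    - x * (mpsC p1 * (b ^+ 2 + b * b' + b' ^+ 2) + mpsC p2 * x * (b + b')
           + mpsC p3 * x ^+ 2) by rewrite /g1; ring.
  by rewrite mcoefB mcoefX0M subr0 c0.
have g20 : g2 0%MM = 0 by rewrite /g2 mulrC c0 // mcoefD e0 e'0 addr0.
apply: eqtrunc_eq; elim=> [//|d IH] m; rewrite ltnS leq_eqVlt => /predU1P[dm|]; last exact: IH.
have eIH : eqtrunc d (euler D) 0 by move=> q lt; rewrite -[LHS]/(D q *+ mdeg q) IH // mul0rn.
have := congr1 (fun f : mps 1 R => f m) key.
rewrite mcoefD (mcoefM_lead g1 IH dm) (mcoefM_lead g2 eIH dm) g10 g20 !mulr0 addr0.
have -> : (2 : mps 1 R) = 1 + 1 by ring.
rewrite mulrDl !mul1r mcoefD (mcoefM_lead _ eIH dm) !exprS expr0 !mcoefM0 b'0.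
rewrite mcoef1 eqxx !mulr1 -[euler D m]/(D m *+ mdeg m) dm -mulrnDr addnn mcoef0.
case: d IH dm eIH => [|d] IH dm eIH; last by rewrite doubleS => /tf.
by move: dm => /eqP; rewrite mdeg_eq0 => /eqP -> _; rewrite mcoefB b0 b'0 subrr.
Qed.

(** Certificate for an equality modulo two others: with the multipliers [c] and [c'] supplied, the
    last premise is a polynomial identity for [ring]. With a single equation, it is given twice and
    [c'] is 0. *)
Lemma lincomb (K : comPzRingType) (a b c c' l r l' r' : K) :
  l = r -> l' = r' -> a + c * l + c' * l' = b + c * r + c' * r' -> a = b.
Proof. by move=> -> -> /addIr /addIr. Qed.

(* This is [d^2 L = Q'(L) / 2], obtained by differentiating [(d L)^2 = Q(L)]. *)
Lemma on_curve_deriv (p1 p2 p3 p4 : R) b : on_curve p1 p2 p3 p4 b ->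
  let b1 := mps_deriv ord0 b in
  let b2 := mps_deriv ord0 b1 in
  4 * b ^+ 3 + 3 * mpsC p1 * x * b ^+ 2 + 2 * mpsC p2 * x ^+ 2 * b + mpsC p3 * x ^+ 3
  = 4 * b ^+ 2 * (b - x * b1) - 2 * x * b * b1 * (b - x * b1) + 2 * x ^+ 2 * b ^+ 2 * b2.
Proof.
move=> [b0 bE] b1 b2; move: bE; rewrite eulerE -/b1 => bE.
(* Differentiating a squared quantity leaves this factor, which represents [d L] up to sign and a
   monomial and can be cancelled since its constant term is 1. *)
apply: (@mps_mulI _ _ (b - x * b1)); first by rewrite mcoefB mcoefX0M subr0.
have := congr1 (mps_deriv ord0) bE.
rewrite !(exprS, expr0, mulr1) !(mps_derivM, mps_derivD, mps_derivN, mps_derivC).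
rewrite mps_derivX eqxx mulr1n -/b1 -/b2 => dE.
(* The operator [4 - x d/dx] kills [x ^+ 4], which eliminates [p4]. *)
apply: (lincomb (c := 4) (c' := - x) bE dE); ring.
Qed.

End Curve.

Lemma mps_map_euler (R S : comPzRingType) (phi : {rmorphism R -> S}) (b : mps 1 R) :
  mps_map phi (euler b) = euler (mps_map phi b).
Proof. by apply: mpsP => m; rewrite /= rmorphMn. Qed.

Lemma on_curve_map (R S : comPzRingType) (phi : {rmorphism R -> S})
    (p1 p2 p3 p4 : R) b :
  on_curve p1 p2 p3 p4 b ->
  on_curve (phi p1) (phi p2) (phi p3) (phi p4) (mps_map phi b).
Proof.
case=> b0 /(congr1 (mps_map phi)) bE; split; first by rewrite /= b0 rmorph1.
move: bE; rewrite !(mps_mapD, mps_mapM, mps_mapXn, mps_mapN) mps_map_euler.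
by rewrite !mps_mapC !(mps_mapX phi ord0).
Qed.

(** By [is_calB_euler], [calB - euler calB] is [calB] times [calR] at [x / calB], and the square of
    [calR] is the quartic. *)
Lemma on_curve_calB : on_curve p1 p2 p3 p4 calB.
Proof.
have [b0 _] := calBP; split=> //.
have /(is_calB_euler b0) := calBP; set r := _ \So _ => bE.
set V := mpsV calB in r bE *; have bV : calB * V = 1 := mpsV_mul b0.
have u0 : null_tuple [tuple (mpsX ord0 : mps 1 Qp) * V].
  by apply: null_tuple1; apply: mcoefX0M.
have r2 : r ^+ 2 = quartic \So [tuple mpsX ord0 * V].
  have [_ <-] := calRP; apply/esym/mps_substXn; exact: u0.
move: r2; rewrite /quartic !mps_substD !(mps_substM _ _ u0, mps_substXn _ _ u0, mps_substC _ u0).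
rewrite mpsC1 mps_subst_X1 ?mcoefX0M // => r2.
have -> : calB - euler calB = calB * r by rewrite bE; ring.
rewrite exprMn r2.
(* The inverse [V] is cleared by pairing each factor [V] with one of the four factors [calB]. *)
transitivity (calB ^+ 4 + mpsC p1 * mpsX ord0 * calB ^+ 3 * (calB * V)
  + mpsC p2 * mpsX ord0 ^+ 2 * calB ^+ 2 * (calB * V) ^+ 2
  + mpsC p3 * mpsX ord0 ^+ 3 * calB * (calB * V) ^+ 3
  + mpsC p4 * mpsX ord0 ^+ 4 * (calB * V) ^+ 4); first by ring.
by rewrite bV !expr1n !mulr1.
Qed.

(** * Buchstaber laws and the equation *)

Section YAdic.
Variable R : comPzRingType.
Implicit Types (f g : mps 2 R).
Local Notation x := (mpsX ord0 : mps 2 R).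
Local Notation y := (mpsX ord_max : mps 2 R).
Local Notation dx := (mps_deriv (ord0 : 'I_2)).
Local Notation dy := (mps_deriv (ord_max : 'I_2)).

Definition yadic k f := forall m : 'X_{1..2}, (m ord_max < k)%N -> f m = 0.

Lemma yadicD k f g : yadic k f -> yadic k g -> yadic k (f + g).
Proof. by move=> fk gk m lt; rewrite mcoefD fk ?gk ?addr0. Qed.
Lemma yadicM k f g : yadic k f -> yadic k (g * f).
Proof.
move=> fk m lt; rewrite mcoefM big1 // => j le; rewrite fk ?mulr0 //.
by apply: leq_ltn_trans lt; rewrite mnmBE leq_subr.
Qed.
Lemma yadic_mulY k f : yadic k f -> yadic k.+1 (y * f).
Proof.
move=> fk m; rewrite ltnS => lt; have [m0|m_gt0] := posnP (m ord_max).
  rewrite mcoefM big1 // => j /mnm_lepP /(_ ord_max); rewrite m0 leqn0 => /eqP j0 /=.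
  by case: eqP => [jU|_]; rewrite ?mul0r //; move: j0; rewrite jU mnm1E.
have mE : m = (m - U_(ord_max) + U_(ord_max))%MM by rewrite submK // lep1mP -lt0n.
by rewrite mE mps_mulX_coef fk // mnmBE mnm1E eqxx subn1 prednK.
Qed.
Lemma yadic_cancelX k f : yadic k (x * f) -> yadic k f.
Proof.
by move=> fk m lt; rewrite -(mps_mulX_coef ord0) fk // mnmDE mnm1E addn0.
Qed.
Lemma yadic_unit k f g : g 0%MM = 1 -> yadic k (g * f) -> yadic k f.
Proof.
by move=> g1 gf; rewrite -[f]mul1r -(mpsV_mul g1) mulrAC mulrC; apply: yadicM.
Qed.
Lemma yadic_dx k f : yadic k f -> yadic k (dx f).
Proof. by move=> fk m lt /=; rewrite fk ?mul0rn // mnmDE mnm1E addn0. Qed.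
Lemma yadic_ydy k f : yadic k f -> yadic k (y * dy f).
Proof.
case: k => [//|k] fk; apply: yadic_mulY => m lt /=.
by rewrite fk ?mul0rn // mnmDE mnm1E eqxx addn1.
Qed.
Lemma yadic_dy k f : torsion_free R -> yadic 1 f -> yadic k (dy f) -> yadic k.+1 f.
Proof.
move=> tf f1 fk m; rewrite ltnS => lt; have [m0|m_gt0] := posnP (m ord_max).
  by rewrite f1 // m0.
have mE : m = (m - U_(ord_max) + U_(ord_max))%MM by rewrite submK // lep1mP -lt0n.
rewrite mE; apply: (tf _ ((m - U_(ord_max))%MM ord_max)).
rewrite -[LHS]/(dy f (m - U_(ord_max))%MM) fk //.
by rewrite mnmBE mnm1E eqxx subn1 prednK.
Qed.
Lemma yadic_eq0 f : (forall k, yadic k f) -> f = 0.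
Proof. by move=> fk; apply: mpsP => m; apply: (fk (m ord_max).+1). Qed.

Lemma yadic1 f : aty0 f = 0 -> yadic 1 f.
Proof.
move=> f0 m; rewrite ltnS leqn0 => /eqP m0.
have := congr1 (fun g : mps 1 R => g (U_(ord0) *+ m ord0)%MM) f0.
rewrite aty0E mdegMn mdeg1 mul1n /= => <-; congr (f _); apply/mnmP.
case; case=> [|[|]] // lt; rewrite mulmnE mnm1E /= ?mul1n ?mul0n.
  by congr (m _); apply: val_inj.
by rewrite -[RHS]m0; congr (m _); apply: val_inj.
Qed.

End YAdic.

(* [x y (num * delta den - den * delta num)] is the combination
   [2 (x^4 E1(y) - y^4 E1(x)) - den (y^3 E2(x) + x^3 E2(y))] of the equation [E1] of the
   curve and its derivative [E2], where [a] and [e] stand for [A(x)] and [A(y)]. *)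
Lemma curve_identity (K : comPzRingType)
    (x y b b1 b2 d d1 d2 p1 p2 p3 p4 a a' e e' : K) :
  4 * d ^+ 3 + 3 * p1 * y * d ^+ 2 + 2 * p2 * y ^+ 2 * d + p3 * y ^+ 3 =
    4 * d ^+ 2 * (d - y * d1) - 2 * y * d * d1 * (d - y * d1) + 2 * y ^+ 2 * d ^+ 2 * d2 ->
  4 * b ^+ 3 + 3 * p1 * x * b ^+ 2 + 2 * p2 * x ^+ 2 * b + p3 * x ^+ 3 =
    4 * b ^+ 2 * (b - x * b1) - 2 * x * b * b1 * (b - x * b1) + 2 * x ^+ 2 * b ^+ 2 * b2 ->
  d ^+ 2 * (d - y * d1) ^+ 2 = d ^+ 4 + p1 * y * d ^+ 3 + p2 * y ^+ 2 * d ^+ 2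
    + p3 * y ^+ 3 * d + p4 * y ^+ 4 ->
  b ^+ 2 * (b - x * b1) ^+ 2 = b ^+ 4 + p1 * x * b ^+ 3 + p2 * x ^+ 2 * b ^+ 2
    + p3 * x ^+ 3 * b + p4 * x ^+ 4 ->
  4 * e' = 8 * d * d1 - 2 * d * d1 - 2 * y * d1 ^+ 2 - 2 * y * d * d2
    + p1 * d + p1 * y * d1 ->
  4 * a' = 8 * b * b1 - 2 * b * b1 - 2 * x * b1 ^+ 2 - 2 * x * b * b2
    + p1 * b + p1 * x * b1 ->
  4 * e = 4 * d ^+ 2 - 2 * y * d * d1 + p1 * y * d ->
  4 * a = 4 * b ^+ 2 - 2 * x * b * b1 + p1 * x * b ->
  4 * (x * (y * ((x ^+ 2 * e - y ^+ 2 * a) * (2 * b * d - y * b * b1 - x * d * d1)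
    - (x * d - y * b) * (b * (2 * x * e - y ^+ 2 * a') - d * (x ^+ 2 * e' - 2 * y * a)))))
  = 0.
Proof.
move=> /eqP; rewrite -subr_eq0 => /eqP E2y /eqP; rewrite -subr_eq0 => /eqP E2x.
move=> /eqP; rewrite -subr_eq0 => /eqP E1y /eqP; rewrite -subr_eq0 => /eqP E1x.
move=> e'E a'E eE aE.
transitivity (x * (y * ((x ^+ 2 * (4 * e) - y ^+ 2 * (4 * a))
      * (2 * b * d - y * b * b1 - x * d * d1)
    - (x * d - y * b) * (b * (2 * x * (4 * e) - y ^+ 2 * (4 * a'))
       - d * (x ^+ 2 * (4 * e') - 2 * y * (4 * a)))))); first by ring.
rewrite e'E a'E eE aE.
have lin c1 c2 c3 c4 h1 h2 h3 h4 (z : K) : h1 = 0 -> h2 = 0 -> h3 = 0 -> h4 = 0 ->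
    z = c1 * h1 + c2 * h2 + c3 * h3 + c4 * h4 -> z = 0.
  by move=> -> -> -> -> ->; rewrite !mulr0 !addr0.
apply: (lin (2 * x ^+ 4) (- 2 * y ^+ 4) ((x * d - y * b) * y ^+ 3)
  ((x * d - y * b) * x ^+ 3) _ _ _ _ _ E1y E1x E2x E2y); ring.
Qed.

Section Buchstaber.
Variable R : comPzRingType.
Implicit Types (f : mps 1 R) (A B : mps 1 R) (F G : mps 2 R).
Local Notation t := (mpsX ord0 : mps 1 R).
Local Notation x := (mpsX ord0 : mps 2 R).
Local Notation y := (mpsX ord_max : mps 2 R).
Local Notation dx := (mps_deriv (ord0 : 'I_2)).
Local Notation dy := (mps_deriv (ord_max : 'I_2)).
Local Notation D1 := (mps_deriv (ord0 : 'I_1)).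

Definition inx f : mps 2 R := f \So [tuple mpsX ord0].
Definition iny f : mps 2 R := f \So [tuple mpsX ord_max].

Lemma null_inx : null_tuple [tuple x].
Proof. by apply: null_tuple1; apply: mcoefX0. Qed.
Lemma null_iny : null_tuple [tuple y].
Proof. by apply: null_tuple1; apply: mcoefX0. Qed.

Lemma iny0 f : iny f 0%MM = f 0%MM. Proof. exact: mps_subst_coef0 null_iny. Qed.

Lemma dx_x : dx x = 1. Proof. by rewrite mps_derivX eqxx. Qed.
Lemma dx_y : dx y = 0. Proof. by rewrite mps_derivX. Qed.
Lemma dy_x : dy x = 0. Proof. by rewrite mps_derivX. Qed.
Lemma dy_y : dy y = 1. Proof. by rewrite mps_derivX eqxx. Qed.
Lemma dx_inx f : dx (inx f) = inx (D1 f).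
Proof. by rewrite /inx mps_deriv_subst1 ?mcoefX0 // dx_x mulr1. Qed.
Lemma dy_inx f : dy (inx f) = 0.
Proof. by rewrite /inx mps_deriv_subst1 ?mcoefX0 // dy_x mulr0. Qed.
Lemma dx_iny f : dx (iny f) = 0.
Proof. by rewrite /iny mps_deriv_subst1 ?mcoefX0 // dx_y mulr0. Qed.
Lemma dy_iny f : dy (iny f) = iny (D1 f).
Proof. by rewrite /iny mps_deriv_subst1 ?mcoefX0 // dy_y mulr1. Qed.
Definition deriv_xyE := (dx_x, dx_y, dy_x, dy_y, dx_inx, dy_inx, dx_iny, dy_iny).

Lemma aty0_inx f : aty0 (inx f) = f.
Proof.
rewrite /aty0 mps_subst_comp1 ?mcoefX0 //; last exact: null_aty0.
by rewrite -/(aty0 _) aty0_x mps_subst_id1.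
Qed.
Lemma aty0_iny f : aty0 (iny f) = mpsC (f 0%MM).
Proof.
rewrite /aty0 mps_subst_comp1 ?mcoefX0 //; last exact: null_aty0.
by rewrite -/(aty0 _) aty0_y mps_subst1_at0.
Qed.

Lemma inxD f g : inx (f + g) = inx f + inx g. Proof. exact: mps_substD. Qed.
Lemma inxN f : inx (- f) = - inx f. Proof. exact: mps_substN. Qed.
Lemma inxM f g : inx (f * g) = inx f * inx g. Proof. exact: mps_substM null_inx. Qed.
Lemma inxXn f n : inx (f ^+ n) = inx f ^+ n. Proof. exact: mps_substXn null_inx. Qed.
Lemma inxC c : inx (mpsC c) = mpsC c. Proof. exact: mps_substC null_inx. Qed.
Lemma inx_t : inx t = x. Proof. exact: mps_substX null_inx. Qed.
Lemma inx_nat n : inx n%:R = n%:R.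
Proof. by elim: n => [|n IH]; [exact: mps_subst0 | rewrite -natr1 inxD IH [inx 1]inxC natr1]. Qed.
Definition inxE := (inx_nat, inxXn, inxC, inx_t, inxD, inxN, inxM).

Lemma inyD f g : iny (f + g) = iny f + iny g. Proof. exact: mps_substD. Qed.
Lemma inyN f : iny (- f) = - iny f. Proof. exact: mps_substN. Qed.
Lemma inyM f g : iny (f * g) = iny f * iny g. Proof. exact: mps_substM null_iny. Qed.
Lemma inyXn f n : iny (f ^+ n) = iny f ^+ n. Proof. exact: mps_substXn null_iny. Qed.
Lemma inyC c : iny (mpsC c) = mpsC c. Proof. exact: mps_substC null_iny. Qed.
Lemma iny_t : iny t = y. Proof. exact: mps_substX null_iny. Qed.
Lemma iny_nat n : iny n%:R = n%:R.
Proof. by elim: n => [|n IH]; [exact: mps_subst0 | rewrite -natr1 inyD IH [iny 1]inyC natr1]. Qed.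
Definition inyE := (iny_nat, inyXn, inyC, iny_t, inyD, inyN, inyM).

Definition den B := x * iny B - y * inx B.
Definition num A := x ^+ 2 * iny A - y ^+ 2 * inx A.

(* The derivation annihilating the series in [x +_F y] when [dt / B(t)] is the
   invariant differential. *)
Definition delta B F := inx B * dx F - iny B * dy F.

Lemma delta_den B : delta B (den B) =
  2 * inx B * iny B - y * inx B * inx (D1 B) - x * iny B * iny (D1 B).
Proof. by rewrite /delta /den !(mps_derivD, mps_derivN, mps_derivM, deriv_xyE); ring. Qed.

Lemma delta_num A B : delta B (num A) =
  inx B * (2 * x * iny A - y ^+ 2 * inx (D1 A))
  - iny B * (x ^+ 2 * iny (D1 A) - 2 * y * inx A).
Proof.
by rewrite /delta /num !expr2 !(mps_derivD, mps_derivN, mps_derivM, deriv_xyE); ring.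
Qed.

Lemma deltaM B F G : delta B (F * G) = delta B F * G + F * delta B G.
Proof. by rewrite /delta !mps_derivM; ring. Qed.
Lemma deltaB B F G : delta B (F - G) = delta B F - delta B G.
Proof. by rewrite /delta !(mps_derivD, mps_derivN); ring. Qed.

(** The hypothesis says [x B(y) F = y B(x) F]. Divisibility of [F] by a power of [y] thus improves
    by one, as [B(y)] is a unit and [x] can be cancelled; iterating forces [F = 0]. *)
Lemma den_regular B F : B 0%MM = 1 -> den B * F = 0 -> F = 0.
Proof.
move=> B0 e; apply: yadic_eq0; elim=> [//|k IH].
apply: (@yadic_unit _ _ _ (iny B)); first by rewrite iny0.
apply: yadic_cancelX; have -> : x * (iny B * F) = y * (inx B * F) + den B * F.
  by rewrite /den; ring.
by rewrite e addr0; apply/yadic_mulY/yadicM.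
Qed.

(** The defect [W] satisfies the linear equation [den * delta W = W * delta den] and vanishes at
    [y = 0]. The equation expresses [x B(y)^2 dW/dy] through [dW/dx], [y dW/dy] and [W], so a power
    of [y] dividing [W] also divides [dW/dy]; integrating in [y] raises the order of [W] by one. *)
Lemma delta_uniq A B G : torsion_free R -> B 0%MM = 1 -> A 0%MM = 1 -> aty0 G = t ->
  delta B G = 0 -> num A * delta B (den B) = den B * delta B (num A) ->
  G * den B = num A.
Proof.
move=> tf B0 A0 G0 dG e; apply/eqP; rewrite -subr_eq0; apply/eqP.
set W := _ - _; have W0 : yadic 1 W.
  apply: yadic1; rewrite /W /den /num.
  rewrite !(aty0D, aty0N, aty0M, aty0Xn) G0 aty0_x aty0_y !aty0_iny B0 A0.
  by rewrite mpsC1 expr0n /=; ring.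
have eW : den B * delta B W = W * delta B (den B).
  rewrite {1}/W deltaB deltaM dG mul0r add0r mulrBr -e /W; ring.
apply: yadic_eq0; elim=> [//|[//|k] IH]; apply: (yadic_dy tf W0).
apply: (@yadic_unit _ _ _ (iny B ^+ 2)); first by rewrite expr2 mcoefM0 iny0 B0 mulr1.
apply: yadic_cancelX.
have -> : x * (iny B ^+ 2 * dy W) = (den B * inx B) * dx W
    + inx B * iny B * (y * dy W) + (- delta B (den B)) * W.
  by apply: (lincomb (c := 1) (c' := 0) eW eW); rewrite /delta /den; ring.
apply: yadicD; last exact: yadicM.
by apply: yadicD; apply: yadicM; [apply: yadic_dx | apply: yadic_ydy].
Qed.

Lemma num_delta_den A B F : F * den B = num A -> delta B F = 0 ->
  num A * delta B (den B) = den B * delta B (num A).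
Proof. by move=> <- dF; rewrite deltaM dF; ring. Qed.

Lemma curve_num_den (p1 p2 p3 p4 : R) A B : torsion_free R ->
  on_curve p1 p2 p3 p4 B ->
  4 * A = 4 * B ^+ 2 - 2 * t * B * D1 B + mpsC p1 * t * B ->
  num A * delta B (den B) = den B * delta B (num A).
Proof.
move=> tf BE AE; have [B0 _] := BE.
have E2 := on_curve_deriv BE; have [_] := BE; rewrite eulerE => E1.
set B1 := D1 B in AE E1 E2; set B2 := D1 B1 in E2.
have A'E : 4 * D1 A = 8 * B * B1 - 2 * B * B1 - 2 * t * B1 ^+ 2 - 2 * t * B * B2
    + mpsC p1 * B + mpsC p1 * t * B1.
  have := congr1 D1 AE; rewrite !expr2.
  rewrite !(mps_deriv_nat, mps_derivD, mps_derivN, mps_derivM, mps_derivC).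
  rewrite mps_derivX eqxx mulr1n -/B1 -/B2 => A'E.
  by apply: (lincomb (c := -1) (c' := 0) A'E A'E); ring.
(* The factors [x], [y] and 4 that make the identity polynomial with integer coefficients are
   cancelled at the end. *)
have z : 4 * (x * (y * (num A * delta B (den B) - den B * delta B (num A)))) = 0.
  rewrite delta_den delta_num -/B1 /den /num.
  have := congr1 inx AE; have := congr1 iny AE.
  have := congr1 inx A'E; have := congr1 iny A'E.
  have := congr1 inx E1; have := congr1 iny E1.
  have := congr1 inx E2; have := congr1 iny E2.
  rewrite !inxE !inyE.
  exact: curve_identity.
apply/eqP; rewrite -subr_eq0; apply/eqP.
apply: (@mps_mulX_inj _ _ ord_max); apply: (@mps_mulX_inj _ _ ord0); rewrite !mulr0.
exact: (torsion_freeM (torsion_free_mps tf)) z.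
Qed.

End Buchstaber.

(** * From a Buchstaber law to its curve *)

Section Converse.
Variable R : comPzRingType.
Implicit Types (A B : mps 1 R) (F G : mps 2 R).
Local Notation t := (mpsX ord0 : mps 1 R).
Local Notation x := (mpsX ord0 : mps 2 R).
Local Notation y := (mpsX ord_max : mps 2 R).
Local Notation dx := (mps_deriv (ord0 : 'I_2)).
Local Notation dy := (mps_deriv (ord_max : 'I_2)).
Local Notation D1 := (mps_deriv (ord0 : 'I_1)).

Lemma fgl_aty0 F : is_fgl F -> aty0 F = t. Proof. by case. Qed.

Lemma fgl_coef0 F : is_fgl F -> F 0%MM = 0.
Proof.
move=> /fgl_aty0 /(congr1 (fun g : mps 1 R => g 0%MM)).
by rewrite /aty0 mps_subst_coef0 ?mcoefX0 //; apply: null_aty0.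
Qed.

Lemma aty0_subst n F (g : mps n R) : g 0%MM = 0 ->
  F \So [tuple g; 0] = aty0 F \So [tuple g].
Proof.
move=> g0; rewrite /aty0 mps_subst_comp2 ?mcoefX0 //; last exact: null_tuple1.
by rewrite mps_subst_X1 // mps_subst0.
Qed.

(** Differentiate [F(F(x,y),z) = F(x,F(y,z))] in [z] and put [z = 0], using [F(y,0) = y]. *)
Lemma fgl_dy F : is_fgl F ->
  iny (aty0 (dy F)) * dy F = aty0 (dy F) \So [tuple F].
Proof.
move=> FG; have F0 := fgl_coef0 FG; have Ft := fgl_aty0 FG.
case: FG => _ _ _ FA.
pose X : mps 3 R := mpsX (@Ordinal 3 0 isT).
pose Y : mps 3 R := mpsX (@Ordinal 3 1 isT).
pose Z : mps 3 R := mpsX (@Ordinal 3 2 isT).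
have X0 : X 0%MM = 0 := mcoefX0 _ _; have Y0 : Y 0%MM = 0 := mcoefX0 _ _.
have Z0 : Z 0%MM = 0 := mcoefX0 _ _.
have FXY0 : (F \So [tuple X; Y]) 0%MM = 0.
  by rewrite mps_subst_coef0 //; apply: null_tuple2.
have FYZ0 : (F \So [tuple Y; Z]) 0%MM = 0.
  by rewrite mps_subst_coef0 //; apply: null_tuple2.
have := congr1 (mps_deriv (@Ordinal 3 2 isT)) FA; rewrite -/X -/Y -/Z.
rewrite !mps_deriv_subst2 // !mps_derivX eqxx /= !(mulr0, mulr1, addr0, add0r).
pose v := [tuple x; y; 0]; have v0 : null_tuple v.
  by case; case=> [|[|[|]]] // lt; apply: mcoefX0.
move/(congr1 (fun f => f \So v)); rewrite mps_substM //.
have Xv : X \So v = x by rewrite mps_substX.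
have Yv : Y \So v = y by rewrite mps_substX.
have Zv : Z \So v = 0 by rewrite mps_substX.
rewrite (mps_subst_comp2 _ FXY0 Z0 v0) (mps_subst_comp2 _ X0 FYZ0 v0).
rewrite (mps_subst_comp2 _ X0 Y0 v0) !(mps_subst_comp2 _ Y0 Z0 v0) Xv Yv Zv !mps_subst_id2.
rewrite !aty0_subst ?mcoefX0 // Ft mps_subst_X1 ?mcoefX0 // mps_subst_id2 => ->.
by rewrite mulrC.
Qed.

(** Symmetry of [F] exchanges its partial derivatives, so this is [fgl_dy] with [x] and [y]
    swapped. *)
Lemma fgl_dx F : is_fgl F ->
  inx (aty0 (dy F)) * dx F = aty0 (dy F) \So [tuple F].
Proof.
move=> FG; have F0 := fgl_coef0 FG; have dyF := fgl_dy FG.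
case: FG => _ _ FC _; set B := aty0 _ in dyF *.
have u0 : null_tuple [tuple y; x] by apply: null_tuple2; rewrite mcoefX0.
have -> : dx F = dy F \So [tuple y; x].
  by rewrite -[in LHS]FC mps_deriv_subst2 ?mcoefX0 // dx_y dx_x mulr0 mulr1 add0r.
have -> : inx B = iny B \So [tuple y; x].
  by rewrite /inx /iny mps_subst_comp1 ?mcoefX0 // mps_subst_Xr ?mcoefX0.
by rewrite -mps_substM // dyF mps_subst_comp1 // FC.
Qed.

Lemma fgl_delta F : is_fgl F -> delta (aty0 (dy F)) F = 0.
Proof. by move=> FG; rewrite /delta fgl_dx // fgl_dy // subrr. Qed.

Lemma fgl_invdiff0 F : is_fgl F -> aty0 (dy F) 0%MM = 1.
Proof.
case=> _ Ft _ _; have u0 : null_tuple [tuple 0; t].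
  by apply: null_tuple2; rewrite ?mcoefX0.
have := congr1 D1 Ft; rewrite mps_deriv_subst2 ?mcoefX0 // mps_deriv0 mulr0 add0r.
rewrite mps_derivX eqxx mulr1 => /(congr1 (fun g : mps 1 R => g 0%MM)).
by rewrite mps_subst_coef0 // mcoef1 eqxx /aty0 mps_subst_coef0 //; apply: null_aty0.
Qed.

Lemma aty0_0 : aty0 (0 : mps 2 R) = 0. Proof. exact: mps_subst0. Qed.

Definition aty0_simp := (aty0_0, @aty0Xn R, @aty0_1 R, @aty0C R, @aty0_x R, @aty0_y R, @aty0_inx R,
  @aty0_iny R, @aty0D R, @aty0N R, @aty0M R).

Lemma aty0_nat k : aty0 (k%:R : mps 2 R) = k%:R.
Proof.
by elim: k => [|k IH]; [exact: mps_subst0 | rewrite -natr1 aty0D IH aty0_1 natr1].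
Qed.

(** The terms of order 1 in [y] show that [dF/dy(x,0)] differs from [B] by a multiple of [x], which
    cancels in [den]. *)
Lemma den_normalized F A B : buchstaber_form F A B -> aty0 F = t ->
  den (aty0 (dy F)) = den B.
Proof.
case=> A0 B0 FE Ft; have := congr1 (fun f => aty0 (dy f)) FE.
rewrite -/(inx A) -/(iny A) -/(inx B) -/(iny B) !expr2.
rewrite !(mps_derivD, mps_derivN, mps_derivM, deriv_xyE) !aty0_simp Ft A0 B0 mpsC1.
set a := mpsC _; set b := mpsC _ => e.
have -> : aty0 (dy F) = B + mpsC (D1 A 0%MM - D1 B 0%MM) * t.
  apply: (@mps_mulX_inj _ _ ord0); rewrite mpsCD mpsCN -/a -/b.
  by apply: (lincomb (c := -1) (c' := 0) e e); ring.
by rewrite /den !inxE !inyE; ring.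
Qed.

Lemma aty0_dyM (f g : mps 2 R) :
  aty0 (dy (f * g)) = aty0 (dy f) * aty0 g + aty0 f * aty0 (dy g).
Proof. by rewrite mps_derivM aty0D !aty0M. Qed.

Lemma aty0_dy2M (f g : mps 2 R) : aty0 (dy (dy (f * g))) =
  aty0 (dy (dy f)) * aty0 g + 2 * aty0 (dy f) * aty0 (dy g) + aty0 f * aty0 (dy (dy g)).
Proof. by rewrite mps_derivM mps_derivD aty0D !aty0_dyM; ring. Qed.

(* Expanding [num * delta den = den * delta num] to second order in [y] gives, in order 1,
   [A] in terms of [B] and, in order 2, a differential equation of order 2 for [B]; the
   latter integrates once, [p4] being the constant of integration. *)
Lemma buchstaber_curve F A0 B0 : torsion_free R -> is_fgl F -> buchstaber_form F A0 B0 ->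
  let B := aty0 (dy F) in
  exists p1 p2 p3 p4 : R, on_curve p1 p2 p3 p4 B /\
    4 * (F * den B) = num (4 * B ^+ 2 - 2 * t * B * D1 B + mpsC p1 * t * B).
Proof.
move=> tf FG FB B; have Ft := fgl_aty0 FG.
have dB := den_normalized FB Ft; rewrite -/B in dB.
case: FB => A00 _; rewrite -/(inx A0) -/(iny A0) -/(inx B0) -/(iny B0).
rewrite -/(den B0) -/(num A0) -dB; move: A0 A00 {B0 dB} => A A0 FE.
have B0 : B 0%MM = 1 := fgl_invdiff0 FG.
have E := num_delta_den FE (fgl_delta FG).
pose B1 := D1 B; pose A1 := D1 A; pose B2 := D1 B1; pose A2 := D1 A1.
pose a1 := mpsC (A1 0%MM) : mps 1 R; pose a2 := mpsC (A2 0%MM) : mps 1 R.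
pose a3 := mpsC (D1 A2 0%MM) : mps 1 R.
pose b1 := mpsC (B1 0%MM) : mps 1 R; pose b2 := mpsC (B2 0%MM) : mps 1 R.
pose b3 := mpsC (D1 B2 0%MM) : mps 1 R.
pose jetE := (mps_deriv_nat, mps_derivD, mps_derivN, mps_derivM, mps_deriv0, mps_deriv1,
  deriv_xyE).
(* For each of the four series in [E], the restrictions to [y = 0] of the series and of its first
   two derivatives in [y] are computed. *)
have [N0 N1 N2] : [/\ aty0 (num A) = t * t, aty0 (dy (num A)) = t * t * a1
    & aty0 (dy (dy (num A))) = t * t * a2 - 2 * A].
  rewrite /num !expr2; split;
  by rewrite ?jetE !(aty0_nat, aty0_simp) A0 mpsC1 -/A1 -/A2 -/a1 -/a2; ring.
have [D0 D1' D2] : [/\ aty0 (den B) = t, aty0 (dy (den B)) = t * b1 - B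
    & aty0 (dy (dy (den B))) = t * b2].
  rewrite /den; split;
  by rewrite ?jetE !(aty0_nat, aty0_simp) B0 mpsC1 -/B1 -/B2 -/b1 -/b2; ring.
have [M0 M1 M2] : [/\ aty0 (delta B (den B)) = 2 * B - t * b1,
    aty0 (dy (delta B (den B))) = 2 * B * b1 - B * B1 - t * (b1 * b1 + b2)
    & aty0 (dy (dy (delta B (den B)))) = 2 * B * b2 - t * (3 * b1 * b2 + b3)].
  rewrite delta_den; split;
  by rewrite ?jetE !(aty0_nat, aty0_simp) B0 mpsC1 -/B1 -/B2 -/b1 -/b2 -/b3; ring.
have [P0 P1 P2] : [/\ aty0 (delta B (num A)) = 2 * t * B - t * t * a1,
    aty0 (dy (delta B (num A))) = 2 * t * B * a1 - b1 * t * t * a1 - t * t * a2 + 2 * A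
    & aty0 (dy (dy (delta B (num A)))) = B * (2 * t * a2 - 2 * A1)
      - (b2 * t * t * a1 + 2 * b1 * (t * t * a2 - 2 * A) + t * t * a3)].
  rewrite delta_num expr2 expr2; split;
  by rewrite ?jetE !(aty0_nat, aty0_simp) A0 B0 mpsC1
       -/A1 -/A2 -/a1 -/a2 -/a3 -/B1 -/B2 -/b1 -/b2 -/b3; ring.
have := congr1 (fun G => aty0 (dy (dy G))) E; have := congr1 (fun G => aty0 (dy G)) E.
have := congr1 (@aty0 R) E; rewrite !aty0_dy2M !aty0_dyM !aty0M N0 N1 N2 D0 D1' D2.
rewrite M0 M1 M2 P0 P1 P2 {N0 N1 N2 D0 D1' D2 M0 M1 M2 P0 P1 P2} => {E} E0 E1 E2.
(* Order 0 in [y] only says [A'(0) = B'(0)], multiplied by [t ^+ 3]. *)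
have ab : a1 = b1.
  do 3 apply: (@mps_mulX_inj _ _ ord0).
  by apply: (lincomb (c := -1) (c' := 0) E0 E0); ring.
rewrite {E0} ab in E1 E2.
have R1 : 2 * A = 2 * B * B - t * B * B1 - b1 * t * B + (a2 - b2) * t * t.
  apply: (@mps_mulX_inj _ _ ord0).
  by apply: (lincomb (c := 1) (c' := 0) E1 E1); ring.
have := congr1 D1 R1.
rewrite !(mps_deriv_nat, mps_derivD, mps_derivN, mps_derivM, mps_derivC) mps_derivX eqxx mulr1n.
rewrite -/A1 -/B1 -/B2 => R1'.
(* [p1] is read off from the term [b1 * t * B] of [R1]; [p2] and [p3] appear when [A] and [A1] are
   eliminated from [E2] by means of [R1] and its derivative. *)
pose p1 := - 2 * B1 0%MM; pose p2 := B1 0%MM ^+ 2 - 2 * B2 0%MM.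
pose p3 := 2 * (D1 A2 0%MM - D1 B2 0%MM).
have C2 : mpsC 2 = 2 :> mps 1 R by rewrite -mps_natE.
have p1E : mpsC p1 = - 2 * b1 :> mps 1 R by rewrite mpsC_mul mpsCN C2.
have p2E : mpsC p2 = b1 * b1 - 2 * b2.
  by rewrite /p2 mpsCD mpsCN expr2 !mpsC_mul C2.
have p3E : mpsC p3 = 2 * (a3 - b3).
  by rewrite /p3 mpsC_mul mpsCD mpsCN C2.
have curve2 : 4 * B ^+ 3 + 3 * mpsC p1 * t * B ^+ 2 + 2 * mpsC p2 * t ^+ 2 * B + mpsC p3 * t ^+ 3
  = 4 * B ^+ 2 * (B - t * B1) - 2 * t * B * B1 * (B - t * B1) + 2 * t ^+ 2 * B ^+ 2 * B2.
  rewrite p1E p2E p3E; apply: (lincomb (c := 0) (c' := -2) E2 E2).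
  apply: (lincomb (c := -6 * b1 * t) (c' := 2 * t * B) R1 R1'); ring.
(* Multiplying [curve2] by [B - t * B1] gives Euler's relation of degree 4 for [Z]; without torsion,
   [Z] is then a multiple of [t ^+ 4], and the multiplier is [p4]. *)
pose Z := B ^+ 2 * (B - t * B1) ^+ 2 - (B ^+ 4 + mpsC p1 * t * B ^+ 3
  + mpsC p2 * t ^+ 2 * B ^+ 2 + mpsC p3 * t ^+ 3 * B).
have eZ : euler Z = 4 * Z.
  rewrite eulerE /Z !(exprS, expr0, mulr1).
  rewrite !(mps_derivD, mps_derivN, mps_derivM, mps_derivC) mps_derivX eqxx mulr1n.
  rewrite -/B1 -/B2; apply: (lincomb (c := - (B - t * B1)) (c' := 0) curve2 curve2); ring.
have Z4 : Z = mpsC (Z (U_(ord0) *+ 4)%MM) * t ^+ 4.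
  move: Z eZ => Z eZ.
  apply: mpsP => m; rewrite mpsXnE mcoefCM /=; case: eqP => [->|ne]; first by rewrite mulr1.
  rewrite mulr0; have := congr1 (fun f : mps 1 R => f m) eZ.
  rewrite mulr_natl mcoefMn -[euler Z m]/(Z m *+ mdeg m).
  have [lt|gt|m4] := ltngtP (mdeg m) 4.
  - move=> /esym/eqP; rewrite -(subnK (ltnW lt)) mulrnDr -subr_eq0 addrK => /eqP.
    by rewrite -(subnSK lt); apply: tf.
  - move=> /eqP; rewrite -(subnK (ltnW gt)) mulrnDr -subr_eq0 addrK => /eqP.
    by rewrite -(subnSK gt); apply: tf.
  - by case: ne; rewrite -m4 -mnm1E0.
exists p1, p2, p3, (Z (U_(ord0) *+ 4)%MM); split.
  split=> //; rewrite eulerE -/B1 -Z4 /Z; ring.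
(* The term [(a2 - b2) * t * t] of [R1] cancels in [num]. *)
transitivity (4 * num A); first by rewrite -FE.
have := congr1 (@inx R) R1; have := congr1 (@iny R) R1.
rewrite /num p1E /b1 /a2 /b2 !inxE !inyE => e e'.
by apply: (lincomb (c := - 2 * x ^+ 2) (c' := 2 * y ^+ 2) e e'); ring.
Qed.

End Converse.

(** * The law over [Q[p1, p2, p3, p4]] *)

Section LowCoefficients.
Variable R : comPzRingType.
Implicit Types (f g : mps 1 R).
Local Notation t := (mpsX ord0 : mps 1 R).
Local Notation U1 := (U_(ord0)%MM : 'X_{1..1}).
Local Notation U2 := ((U_(ord0) *+ 2)%MM : 'X_{1..1}).

Definition mps_shift f : mps 1 R := MPS (fun m => f (m + U_(ord0))%MM).

Lemma mps_shiftE f : f = mpsC (f 0%MM) + t * mps_shift f.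
Proof.
apply: mpsP => m; have [->|[k ->]] := mnm1_case m; rewrite mcoefD mcoefC.
  by rewrite mcoefX0M eqxx addr0.
by rewrite mps_mulX_coef -mdeg_eq0 mdegD mdeg1 addn1 add0r.
Qed.

Lemma mcoefM1 f g : (f * g) U1 = f 0%MM * g U1 + f U1 * g 0%MM.
Proof.
rewrite [in LHS](mps_shiftE f) mulrDl mcoefD mcoefCM -mulrA.
by rewrite -{2}[U_(_)%MM]add0m mps_mulX_coef mcoefM0 /= add0m.
Qed.

Lemma mcoefM2 f g : (f * g) U2 = f 0%MM * g U2 + f U1 * g U1 + f U2 * g 0%MM.
Proof.
have -> : U2 = (U1 + U1)%MM by rewrite mulmS mulm1n.
rewrite [in LHS](mps_shiftE f) mulrDl mcoefD mcoefCM -mulrA.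
by rewrite mps_mulX_coef mcoefM1 /= add0m addrA.
Qed.

End LowCoefficients.

Lemma torsion_freeQp : torsion_free Qp.
Proof.
move=> a n; rewrite -scaler_nat => /eqP; rewrite scaler_eq0 => /orP[|/eqP //].
by rewrite Num.Theory.pnatr_eq0.
Qed.

(** * The law with invariant differential [dt / B(t)], and its logarithm *)

Section Law.
Variable B : mps 1 Qp.
Hypothesis B0 : B 0%MM = 1.
Implicit Types (f g l : mps 1 Qp) (F G H : mps 2 Qp).
Local Notation t := (mpsX ord0 : mps 1 Qp).
Local Notation x := (mpsX ord0 : mps 2 Qp).
Local Notation y := (mpsX ord_max : mps 2 Qp).
Local Notation dx := (mps_deriv (ord0 : 'I_2)).
Local Notation dy := (mps_deriv (ord_max : 'I_2)).
Local Notation D1 := (mps_deriv (ord0 : 'I_1)).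

Definition inty F : mps 2 Qp :=
  MPS (fun m => if m ord_max == 0%N then 0
                else ((m ord_max)%:R : rat)^-1 *: F (m - U_(ord_max))%MM).

Lemma dy_inty F : dy (inty F) = F.
Proof.
apply: mpsP => m; rewrite /= mnmDE mnm1E eqxx addn1 /= addmK.
by rewrite -scaler_nat scalerA mulfV ?scale1r // Num.Theory.pnatr_eq0.
Qed.

Lemma aty0_inty F : aty0 (inty F) = 0.
Proof. by apply: mpsP => m; rewrite aty0E /= mulmnE mnm1E. Qed.

Lemma eqtrunc_inty d F G : eqtrunc d F G -> eqtrunc d.+1 (inty F) (inty G).
Proof.
move=> FG m lt /=; case: eqP => [//|/eqP m0]; rewrite FG //.
have mE : m = (m - U_(ord_max) + U_(ord_max))%MM by rewrite submK // lep1mP.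
by move: lt; rewrite {1}mE mdegD mdeg1 addn1.
Qed.

(** The law is built as the flow [B(y) dH/dy = B(H)], [H(x,0) = x], which avoids inverting the
    logarithm under composition. Integration in [y] gains one degree, so the integral equation is a
    causal fixed point. *)
Lemma law_exists : exists2 H, aty0 H = t & iny B * dy H = B \So [tuple H].
Proof.
pose Phi H := x + inty ((B \So [tuple H]) * mpsV (iny B)).
have cPhi : causal Phi.
  move=> d f g fg; apply: eqtruncD => //; apply: eqtrunc_inty; apply: eqtruncM => //.
  exact: eqtrunc_subst1.
have [H HE] := causal_fix cPhi; exists H; rewrite -{1}HE /Phi.
  by rewrite aty0D aty0_x aty0_inty addr0.
rewrite mps_derivD dy_x add0r dy_inty mulrCA mpsV_mul ?mulr1 //.
by rewrite iny0.
Qed.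

Lemma mps_int_deriv f : D1 (mps_int f) = f.
Proof.
apply: mpsP => m; rewrite /= -mdeg_eq0 mdegD mdeg1 addn1 /= addmK -scaler_nat scalerA.
by rewrite [mdeg m]mdegE big_ord1 mulfV ?scale1r // Num.Theory.pnatr_eq0.
Qed.

Lemma mps_deriv1_inj f g : f 0%MM = g 0%MM -> D1 f = D1 g -> f = g.
Proof.
move=> fg0 fg; apply: mpsP => m; have [->//|[k ->]] := mnm1_case m.
apply/eqP; rewrite -subr_eq0; apply/eqP; apply: (torsion_freeQp (n := k ord0)).
by rewrite mulrnBl -[_ *+ _]/(D1 f k) fg subrr.
Qed.

Variable H : mps 2 Qp.
Hypothesis Ht : aty0 H = t.
Hypothesis dH : iny B * dy H = B \So [tuple H].

Lemma law0 : H 0%MM = 0.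
Proof.
have := congr1 (fun g : mps 1 Qp => g 0%MM) Ht.
by rewrite /aty0 mps_subst_coef0 ?mcoefX0 //; apply: null_aty0.
Qed.

Lemma law_invdiff : aty0 (dy H) = B.
Proof.
have := congr1 (@aty0 Qp) dH; rewrite aty0M aty0_iny B0 mpsC1 mul1r => ->.
by rewrite /aty0 mps_subst_comp1 ?law0 -?/(aty0 _) ?Ht ?mps_subst_id1 //; apply: null_aty0.
Qed.

(** Differentiating the additivity of [l] in [y] at [y = 0] gives [l'(x) B(x) = 1]. Conversely, for
    this [l] the series [l(H) - l(x) - l(y)] vanishes at [y = 0] and has zero derivative in [y]. *)
Lemma is_logP l : is_log H l <-> l = mps_int (mpsV B).
Proof.
split=> [[l0 l1 lH]|lE].
  apply: mps_deriv1_inj; first by rewrite l0 /= eqxx.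
  rewrite mps_int_deriv; have := congr1 (fun F => aty0 (dy F)) lH.
  rewrite mps_deriv_subst1 ?law0 // -/(inx l) -/(iny l) mps_derivD dy_inx dy_iny add0r.
  rewrite aty0M law_invdiff aty0_iny /= mnm0E add0m l1 mpsC1.
  rewrite /aty0 mps_subst_comp1 ?law0 //; last exact: null_aty0.
  rewrite -/(aty0 H) Ht mps_subst_id1 => e; apply: (mps_mulI B0).
  by rewrite mulrC e mpsV_mul.
have l0 : l 0%MM = 0 by rewrite lE /= eqxx.
have dl : D1 l = mpsV B by rewrite lE mps_int_deriv.
split=> //.
  have /(congr1 (fun g : mps 1 Qp => g 0%MM)) := dl; rewrite /= mnm0E add0m mulr1n => ->.
  by have := mcoefM0 B (mpsV B); rewrite mpsV_mul // B0 mul1r mcoef1 eqxx.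
rewrite -/(inx l) -/(iny l); apply/eqP; rewrite -subr_eq0; apply/eqP.
apply: (mps_deriv_aty0_inj torsion_freeQp).
  rewrite !(mps_derivD, mps_derivN) dy_inx dy_iny add0r mps_deriv_subst1 ?law0 // dl.
  apply: (@mps_mulI _ _ (iny B)); first by rewrite iny0.
  rewrite mulr0 mulrBr mulrCA dH -inyM mpsV_mul // -mps_substM; last by apply/null_tuple1/law0.
  by rewrite mulrC mpsV_mul // [iny 1]inyC mps_subst1 ?subrr //; apply/null_tuple1/law0.
rewrite aty0D aty0N aty0D aty0_inx aty0_iny l0 mpsC0 addr0.
rewrite /aty0 mps_subst_comp1 ?law0 //; last exact: null_aty0.
by rewrite -/(aty0 H) Ht mps_subst_id1 subrr.
Qed.

(** Write [l = t u] with [u(0) = 1]. Then [(f - g) u(f) = (u(g) - u(f)) g], and since [g] has no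
    constant term, agreement of [f] and [g] below degree [d] extends to degree [d]. *)
Lemma log_inj n (f g : mps n Qp) : f 0%MM = 0 -> g 0%MM = 0 ->
  let l := mps_int (mpsV B) in l \So [tuple f] = l \So [tuple g] -> f = g.
Proof.
move=> f0 g0 l; have [l0 l1 _] := (is_logP l).2 erefl.
rewrite (mps_shiftE l) l0 mpsC0 add0r; set u := mps_shift l.
have u0 : u 0%MM = 1 by rewrite -[LHS]/(l (0 + U_(ord0))%MM) add0m l1.
have nf := null_tuple1 f0; have ng := null_tuple1 g0.
rewrite !mps_substM // !mps_subst_X1 // => e; apply: eqtrunc_eq; elim=> [//|d IH].
have uu : eqtrunc d (u \So [tuple f]) (u \So [tuple g]) by apply: eqtrunc_subst1.
suff z : eqtrunc d.+1 (f - g) 0.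
  by move=> m lt; apply/eqP; rewrite -subr_eq0 -mcoefB z.
have uf1 : (u \So [tuple f]) 0%MM = 1 by rewrite mps_subst_coef0.
rewrite -[f - g]mulr1 -(mpsV_mul uf1) mulrA.
have -> : (f - g) * (u \So [tuple f]) = ((u \So [tuple g]) - (u \So [tuple f])) * g.
  by rewrite mulrBl e; ring.
have z : eqtrunc d.+1 (((u \So [tuple g]) - (u \So [tuple f])) * g) 0.
  by apply: mul_ord1 => // m lt; rewrite mcoefB uu // subrr.
by move=> m lt; rewrite (eqtruncM z (fun _ _ => erefl)) // mul0r.
Qed.

Lemma log_law n (f g : mps n Qp) : f 0%MM = 0 -> g 0%MM = 0 ->
  let l := mps_int (mpsV B) in
  l \So [tuple H \So [tuple f; g]] = (l \So [tuple f]) + (l \So [tuple g]).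
Proof.
move=> f0 g0 l; have [_ _ lH] := (is_logP l).2 erefl.
have u0 := null_tuple2 f0 g0.
rewrite -mps_subst_comp1 ?law0 // lH mps_substD !mps_subst_comp1 ?mcoefX0 //.
by rewrite mps_subst_Xl ?mps_subst_Xr.
Qed.

(** The logarithm is injective and carries [H] to addition, so symmetry and associativity come from
    those of [+]. *)
Lemma law_fgl : is_fgl H.
Proof.
have H0 n (f g : mps n Qp) : f 0%MM = 0 -> g 0%MM = 0 -> (H \So [tuple f; g]) 0%MM = 0.
  by move=> f0 g0; rewrite mps_subst_coef0 ?law0 //; apply: null_tuple2.
have [l0 _ lH] := (is_logP _).2 erefl.
split=> //.
- apply: log_inj; rewrite ?H0 ?mcoefX0 // log_law ?mcoefX0 //.
  by rewrite mps_subst1_at0 l0 mpsC0 add0r.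
- by apply: log_inj; rewrite ?H0 ?law0 ?mcoefX0 // log_law ?mcoefX0 // lH addrC.
- by apply: log_inj; rewrite ?log_law ?H0 ?mcoefX0 // addrA.
Qed.

End Law.

Section CalA.
Local Notation t := (mpsX ord0 : mps 1 Qp).
Local Notation D1 := (mps_deriv (ord0 : 'I_1)).
Local Notation U1 := (U_(ord0)%MM : 'X_{1..1}).
Local Notation U2 := ((U_(ord0) *+ 2)%MM : 'X_{1..1}).

Lemma natr_scale k c (q : Qp) : k%:R * (c *: q) = (k%:R * c) *: q.
Proof. by rewrite mulr_natl -scaler_nat scalerA. Qed.

(* Minus the coefficient of [x^2] in the definition of [calA]; [num] does not depend on the
   term of degree 2 of [A]. *)
Definition calK : Qp := (1 / 16%:R) *: p1 ^+ 2 - (1 / 4%:R) *: p2.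

Lemma calA4 : 4 * (calA + mpsC calK * t ^+ 2) =
  4 * calB ^+ 2 - 2 * t * calB * D1 calB + mpsC p1 * t * calB.
Proof.
have h2 : 4 * mpsC (1 / 2%:R)%:MP = 2 :> mps 1 Qp.
  rewrite natr_mpsC -(rmorph_nat (@mpolyC 4 rat) 4) -rmorphM /=.
  rewrite (_ : 4%:R * _ = 2%:R :> rat) // rmorph_nat.
  by rewrite -mps_natE.
have h4 : 4 * mpsC ((1 / 4%:R) *: p1) = mpsC p1 :> mps 1 Qp.
  by rewrite natr_mpsC natr_scale (_ : 4%:R * _ = 1 :> rat) ?scale1r.
rewrite -h2 -h4 /calA -/calK; ring.
Qed.

(** The term [b ^+ 4] has cancelled, and the powers of [x] are nested so that [mcoefXS] and
    [graded_CX] can strip them one factor at a time. *)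
Lemma on_curve_euler (R : comPzRingType) (q1 q2 q3 q4 : R) (b : mps 1 R) :
  on_curve q1 q2 q3 q4 b ->
  mpsC q1 * (mpsX ord0 * b ^+ 3) + mpsC q2 * (mpsX ord0 * (mpsX ord0 * b ^+ 2))
  + mpsC q3 * (mpsX ord0 * (mpsX ord0 * (mpsX ord0 * b)))
  + mpsC q4 * (mpsX ord0 * (mpsX ord0 * (mpsX ord0 * mpsX ord0)))
  = b ^+ 2 * euler b ^+ 2 - 2 * b ^+ 3 * euler b.
Proof. by case=> _ e; apply: (lincomb (c := 1) (c' := 0) e e); ring. Qed.

Lemma on_curve_coef12 (R : comPzRingType) (q1 q2 q3 q4 : R) (b : mps 1 R) :
  on_curve q1 q2 q3 q4 b -> q1 = - 2 * b U1 /\ q2 = b U1 ^+ 2 - 4 * b U2.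
Proof.
move=> bP; have [b0 _] := bP; have := on_curve_euler bP; set e := euler b => bE.
have e0 : e 0%MM = 0 by apply: euler0.
have e1 : e U1 = b U1 by rewrite /e /= mdeg1.
have e2 : e U2 = 2 * b U2 by rewrite /e /= mdegMn mdeg1 mulr_natl.
have C1 (c : R) : (mpsC c : mps 1 R) U1 = 0 by rewrite mcoefC -mdeg_eq0 mdeg1.
have C2 (c : R) : (mpsC c : mps 1 R) U2 = 0 by rewrite mcoefC -mdeg_eq0 mdegMn mdeg1.
have C0 (c : R) : (mpsC c : mps 1 R) 0%MM = c by rewrite mcoefC eqxx.
have X1 : (mpsX ord0 : mps 1 R) U1 = 1 by rewrite /= eqxx.
have X2 : (mpsX ord0 : mps 1 R) U2 = 0.
  by rewrite /=; case: eqP => // /(congr1 (@mdeg 1)); rewrite mdegMn mdeg1.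
rewrite (mps_natE 1 _ 2) !(exprS, expr0, mulr1) in bE.
pose cE := (mcoefD, mcoefN, mcoefM0, mcoefM1, mcoefM2, C0, C1, C2, mcoefX0, X1, X2, e0, e1, e2, b0).
have E1 := congr1 (fun f : mps 1 R => f U1) bE.
have E2 := congr1 (fun f : mps 1 R => f U2) bE.
rewrite /= !cE in E1; rewrite /= !cE in E2; rewrite {cE}.
have q1E : q1 = - 2 * b U1 by apply: (lincomb (c := -1) (c' := 0) E1 E1); ring.
split=> //; rewrite q1E in E2.
by apply: (lincomb (c := -1) (c' := 0) E2 E2); ring.
Qed.

(** With [b1, b2] the coefficients of [x, x^2] in [calB], one has [p1 = - 2 b1] and
    [p2 = b1^2 - 4 b2]. Hence [calK = b2], which is also the coefficient of [x^2] in the other terms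
    of [calA]. *)
Lemma calA_coef2 : calA U2 = 0.
Proof.
have [p1E p2E] := on_curve_coef12 on_curve_calB; have [b0 _] := calBP.
have C1 (c : Qp) : (mpsC c : mps 1 Qp) U1 = 0 by rewrite mcoefC -mdeg_eq0 mdeg1.
have C2 (c : Qp) : (mpsC c : mps 1 Qp) U2 = 0 by rewrite mcoefC -mdeg_eq0 mdegMn mdeg1.
have C0 (c : Qp) : (mpsC c : mps 1 Qp) 0%MM = c by rewrite mcoefC eqxx.
have X1 : t U1 = 1 by rewrite /= eqxx.
have X2 : t U2 = 0.
  by rewrite /=; case: eqP => // /(congr1 (@mdeg 1)); rewrite mdegMn mdeg1.
have d0 : D1 calB 0%MM = calB U1 by rewrite /= mnm0E add0m mulr1n.
have d1 : D1 calB U1 = 2 * calB U2.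
  by rewrite /= mnm1E eqxx mulmS mulm1n mulr_natl.
have K16 : 16 * calK = p1 ^+ 2 - 4 * p2.
  rewrite /calK mulrBr !natr_scale (_ : 16%:R * _ = 1 :> rat) // scale1r.
  by rewrite (_ : 16%:R * _ = 4%:R :> rat) // scaler_nat mulr_natl.
move: calA calK calA4 K16 => A K AE K16.
have := congr1 (fun f : mps 1 Qp => f U2) AE.
rewrite (mps_natE 1 _ 4) (mps_natE 1 _ 2) !(exprS, expr0, mulr1) /= .
rewrite !(mcoefD, mcoefN, mcoefM0, mcoefM1, mcoefM2, C0, C1, C2, mcoefX0, X1, X2, d0, d1, b0).
(* The index is the predecessor of the common denominator 16. *)
move=> e; apply: (torsion_freeM (n := 15) torsion_freeQp).
move: K16; rewrite p2E => K16; rewrite p1E in e K16.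
apply: (lincomb (c := -4) (c' := 1) e K16); ring.
Qed.

Lemma num_shift (R : comPzRingType) (A : mps 1 R) k :
  num (A + mpsC k * mpsX ord0 ^+ 2) = num A.
Proof. by rewrite /num !inxE !inyE; ring. Qed.

Lemma calB_law H : aty0 H = t -> iny calB * mps_deriv ord_max H = calB \So [tuple H] ->
  buchstaber_form H calA calB.
Proof.
move=> Ht dH; have [b0 _] := calBP; have [l0 l1 lH] := (is_logP b0 Ht dH _).2 erefl.
have A0 : calA 0%MM = 1.
  move: calA calK calA4 => A K AE.
  have := congr1 (fun f : mps 1 Qp => f 0%MM) AE.
  rewrite (mps_natE 1 _ 4) (mps_natE 1 _ 2) !(exprS, expr0, mulr1).
  rewrite !(mcoefD, mcoefN, mcoefM0, mcoefX0, b0).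
  rewrite !mcoefC eqxx => e; apply/eqP; rewrite -subr_eq0; apply/eqP.
  apply: (torsion_freeM (n := 3) torsion_freeQp).
  by apply: (lincomb (c := -1) (c' := 0) e e); ring.
split=> //; rewrite -/(inx calA) -/(iny calA) -/(inx calB) -/(iny calB) -/(num calA) -/(den calB).
rewrite -(num_shift _ calK); apply: (delta_uniq torsion_freeQp b0 _ Ht).
- by rewrite mcoefD expr2 !mcoefM0 mcoefX0 !mulr0 addr0.
- by have := fgl_delta (law_fgl b0 Ht dH); rewrite (law_invdiff b0 Ht dH).
exact: curve_num_den torsion_freeQp on_curve_calB calA4.
Qed.

Lemma calB_normalized H : aty0 H = t -> iny calB * mps_deriv ord_max H = calB \So [tuple H] ->
  normalized H calA calB.
Proof.
move=> Ht dH; have [b0 _] := calBP; split; last exact: calA_coef2.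
by rewrite -[RHS]/(aty0 _) (law_invdiff b0 Ht dH).
Qed.

End CalA.

(** * Grading *)

Section Graded.
Variables (R : comPzRingType) (Gr : nat -> R -> Prop).
Hypothesis Gr0 : forall d, Gr d 0.
Hypothesis Gr1 : Gr 0 1.
Hypothesis GrB : forall d a b, Gr d a -> Gr d b -> Gr d (a - b).
Hypothesis GrM : forall d e a b, Gr d a -> Gr e b -> Gr (d + e) (a * b).
Implicit Types f g : mps 1 R.
Local Notation t := (mpsX ord0 : mps 1 R).

Definition graded_series f := forall m, Gr (mdeg m) (f m).

Lemma GrN d a : Gr d a -> Gr d (- a).
Proof. by move=> aG; rewrite -sub0r; apply: GrB. Qed.
Lemma GrD d a b : Gr d a -> Gr d b -> Gr d (a + b).
Proof. by move=> aG bG; rewrite -[b]opprK; apply/GrB/GrN. Qed.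
Lemma GrMn d a n : Gr d a -> Gr d (a *+ n).
Proof. by move=> aG; elim: n => [|n IH]; rewrite ?mulr0n // mulrS; apply: GrD. Qed.

Lemma graded_seriesB f g : graded_series f -> graded_series g -> graded_series (f - g).
Proof. by move=> fG gG m; rewrite mcoefB; apply: GrB. Qed.
Lemma graded_seriesM f g : graded_series f -> graded_series g -> graded_series (f * g).
Proof.
move=> fG gG m; rewrite mcoefM; elim/big_rec: _ => [//|k a le aG]; apply: GrD => //.
by have := GrM (fG k) (gG (m - k)%MM); rewrite -mdegD addmC submK.
Qed.
Lemma graded_series1 : graded_series 1.
Proof. by move=> m; rewrite mcoef1; case: eqP => [->|_]; rewrite ?mdeg0. Qed.
Lemma graded_seriesXn f n : graded_series f -> graded_series (f ^+ n).
Proof.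
move=> fG; elim: n => [|n IH]; first by rewrite expr0; apply: graded_series1.
by rewrite exprS; apply: graded_seriesM.
Qed.
Lemma graded_seriesMn f n : graded_series f -> graded_series (f *+ n).
Proof. by move=> fG m; rewrite mcoefMn; apply: GrMn. Qed.
Lemma graded_euler f : graded_series f -> graded_series (euler f).
Proof. by move=> fG m; apply: GrMn. Qed.
Lemma graded_CX q k f : Gr k q -> graded_series f ->
  graded_series (mpsC q * (iter k (fun h => t * h) f)).
Proof.
have iterE m : iter k (fun h => t * h) f m = 0 \/
    exists2 j, mdeg m = (k + mdeg j)%N & iter k (fun h => t * h) f m = f j.
  elim: k m => [|k IH] m /=; first by right; exists m.
  have [->|[j ->]] := mnm1_case m; first by left; rewrite mcoefX0M.
  rewrite mps_mulX_coef; have [->|[i ji ->]] := IH j; first by left.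
  by right; exists i => //; rewrite mdegD mdeg1 addn1 ji.
move=> qG fG m; rewrite mcoefCM; have [->|[j -> ->]] := iterE m; first by rewrite mulr0.
exact: GrM.
Qed.

(** As [b] has constant term 1, the coefficient of [x ^+ k] is the k-th parameter plus terms in the
    earlier ones. Subtracting these terms isolates the parameters one after the other, each
    homogeneous of its degree. *)
Lemma on_curve_graded q1 q2 q3 q4 b : on_curve q1 q2 q3 q4 b -> graded_series b ->
  [/\ Gr 1 q1, Gr 2 q2, Gr 3 q3 & Gr 4 q4].
Proof.
move=> bP bG; have [b0 _] := bP; have := on_curve_euler bP.
set s := _ - _ => bE.
have sG : graded_series s.
  rewrite /s -mulrA mulr_natl; apply: graded_seriesB; last apply: graded_seriesMn;
  by apply: graded_seriesM; do ?apply: graded_seriesXn; do ?apply: graded_euler.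
move: s sG bE => s sG bE.
have b1 k : (b ^+ k) 0%MM = 1.
  by elim: k => [|k IH]; rewrite ?expr0 ?mcoef1 ?eqxx // exprS mcoefM0 b0 IH mulr1.
have X0 f : (t * f) (U_(ord0) *+ 0)%MM = 0 by rewrite mulm0n mcoefX0M.
have bk k : graded_series (b ^+ k) := graded_seriesXn k bG.
have dU k : mdeg (U_(ord0) *+ k : 'X_{1..1})%MM = k by rewrite mdegMn mdeg1 mul1n.
have coef k f : graded_series f -> Gr k (f (U_(ord0) *+ k)%MM).
  by move=> fG; rewrite -[X in Gr X _]dU.
have q1G : Gr 1 q1.
  have := coef 1%N _ sG; rewrite -bE !mcoefD !mcoefCM !mcoefXS !X0 !mulm0n.
  by rewrite b1 !mulr0 !addr0 mulr1.
set T1 := mpsC q1 * _ in bE; set T2 := mpsC q2 * _ in bE.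
set T3 := mpsC q3 * _ in bE; set T4 := mpsC q4 * _ in bE.
have T1G : graded_series T1 := graded_CX q1G (bk 3).
have q2G : Gr 2 q2.
  have := coef 2%N _ (graded_seriesB sG T1G); rewrite -bE.
  have -> : T1 + T2 + T3 + T4 - T1 = T2 + T3 + T4 by ring.
  rewrite !mcoefD !mcoefCM !mcoefXS !X0 !mulm0n.
  by rewrite b1 !mulr0 !addr0 mulr1.
have T2G : graded_series T2 := graded_CX q2G (bk 2).
have q3G : Gr 3 q3.
  have := coef 3%N _ (graded_seriesB (graded_seriesB sG T1G) T2G); rewrite -bE.
  have -> : T1 + T2 + T3 + T4 - T1 - T2 = T3 + T4 by ring.
  by rewrite !mcoefD !mcoefCM !mcoefXS !mulm0n mcoefX0 b0 !mulr0 !addr0 mulr1.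
have T3G : graded_series T3 := graded_CX q3G bG.
split=> //.
have := coef 4%N _ (graded_seriesB (graded_seriesB (graded_seriesB sG T1G) T2G) T3G).
rewrite -bE; have -> : T1 + T2 + T3 + T4 - T1 - T2 - T3 = T4 by ring.
by rewrite mcoefCM !mcoefXS !mulm1n /= eqxx mulr1.
Qed.

End Graded.

(** * Scaling of the variables, used to detect weights *)

Section Scale.
Variable n : nat.
Variable R : comPzRingType.
Implicit Types f g : mps n R.

Definition mps_scale f : mps n R := MPS (fun m => 2 ^+ mdeg m * f m).

Lemma mps_scaleD f g : mps_scale (f + g) = mps_scale f + mps_scale g.
Proof. by apply: mpsP => m; rewrite mcoefD /= mulrDr. Qed.
Lemma mps_scaleN f : mps_scale (- f) = - mps_scale f.
Proof. by apply: mpsP => m; rewrite mcoefN /= mulrN. Qed.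
Lemma mps_scaleM f g : mps_scale (f * g) = mps_scale f * mps_scale g.
Proof.
apply: mpsP => m; rewrite [LHS]/= !mcoefM mulr_sumr; apply: eq_bigr => k le /=.
by rewrite mulrACA -exprD -mdegD addmC submK.
Qed.
Lemma mps_scaleC c : mps_scale (mpsC c) = mpsC c.
Proof. by apply: mpsP => m /=; case: eqP => [->|_]; rewrite ?mulr0 // mdeg0 mul1r. Qed.
Lemma mps_scale1 : mps_scale 1 = 1. Proof. exact: mps_scaleC. Qed.
Lemma mps_scaleXn f k : mps_scale (f ^+ k) = mps_scale f ^+ k.
Proof. by elim: k => [|k IH]; rewrite ?expr0 ?mps_scale1 // !exprS mps_scaleM IH. Qed.
Lemma mps_scaleX i : mps_scale (mpsX i) = 2 * mpsX i.
Proof.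
apply: mpsP => m; rewrite mulr_natl mcoefMn /=.
by case: eqP => [->|_]; rewrite ?mulr0 ?mul0rn // mdeg1 mulr1.
Qed.
Lemma eqtrunc_scale d f g : eqtrunc d f g -> eqtrunc d (mps_scale f) (mps_scale g).
Proof. by move=> fg m lt; rewrite /= fg. Qed.
End Scale.

Lemma mps_scale_euler (R : comPzRingType) (f : mps 1 R) :
  mps_scale (euler f) = euler (mps_scale f).
Proof. by apply: mpsP => m; rewrite /= mulrnAr. Qed.

Lemma mps_scale_subst n (R : comPzRingType) (f : mps 1 R) (i : 'I_n) :
  mps_scale (f \So [tuple mpsX i]) = mps_scale f \So [tuple mpsX i].
Proof.
have u0 : null_tuple [tuple (mpsX i : mps n R)] by apply/null_tuple1/mcoefX0.
elim/mps_ind: f => [c|j|f g IHf IHg|f g IHf IHg|f IH].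
- by rewrite mps_scaleC !mps_substC // mps_scaleC.
- rewrite ord1 mps_subst_X1 ?mcoefX0 // !mps_scaleX !mulr2n !mulrDl !mul1r.
  by rewrite mps_substD mps_subst_X1 ?mcoefX0.
- by rewrite mps_substD !mps_scaleD mps_substD IHf IHg.
- by rewrite mps_substM // !mps_scaleM mps_substM // IHf IHg.
apply: eqtrunc_eq => d m lt; have [g fg gE] := IH d.
rewrite (eqtrunc_scale (eqtrunc_subst _ fg)) // gE.
by rewrite -(eqtrunc_subst _ (eqtrunc_scale fg)).
Qed.

Lemma on_curve_scale (R : comPzRingType) (q1 q2 q3 q4 : R) b :
  on_curve q1 q2 q3 q4 b ->
  on_curve (2 * q1) (2 ^+ 2 * q2) (2 ^+ 3 * q3) (2 ^+ 4 * q4) (mps_scale b).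
Proof.
case=> b0 /(congr1 (@mps_scale 1 R)) bE; split; first by rewrite /= mdeg0 mul1r.
move: bE; rewrite !(mps_scaleXn, mps_scaleC, mps_scaleX, mps_scaleD, mps_scaleN, mps_scaleM).
rewrite mps_scale_euler => ->.
rewrite (mps_natE 1 _ 2) !(exprS, expr0, mulr1) !mpsC_mul; ring.
Qed.

Lemma map_inx (R S : comPzRingType) (phi : {rmorphism R -> S}) f :
  mps_map phi (inx f) = inx (mps_map phi f).
Proof. by rewrite /inx mps_map_subst1 mps_mapX. Qed.

Lemma map_iny (R S : comPzRingType) (phi : {rmorphism R -> S}) f :
  mps_map phi (iny f) = iny (mps_map phi f).
Proof. by rewrite /iny mps_map_subst1 mps_mapX. Qed.

Lemma map_den (R S : comPzRingType) (phi : {rmorphism R -> S}) B :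
  mps_map phi (den B) = den (mps_map phi B).
Proof. by rewrite /den !(mps_mapD, mps_mapN, mps_mapM) !mps_mapX map_inx map_iny. Qed.

Lemma map_num (R S : comPzRingType) (phi : {rmorphism R -> S}) A :
  mps_map phi (num A) = num (mps_map phi A).
Proof. by rewrite /num !(mps_mapD, mps_mapN, mps_mapM, mps_mapXn) !mps_mapX map_inx map_iny. Qed.

(* [theta] multiplies an element of weight [k] by [2^k], and [mps_scale] is the substitution
   of [2 x_i] for each variable [x_i]. *)
Definition theta_var (i : 'I_4) : Qp := 2 ^+ i.+1 *: 'X_i.
Definition theta : {rmorphism Qp -> Qp} := mmap (@mpolyC 4 rat) theta_var.

Lemma theta_coef (z : Qp) m : (theta z)@_m = 2 ^+ mnmwgt m * z@_m.
Proof.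
have h1 k : mmap1 theta_var k = 2 ^+ mnmwgt k *: 'X_[k].
  rewrite /mmap1 /theta_var [in RHS]mpolyXE_id /mnmwgt.
  elim/big_rec3: _ => [|i a b c _ ->]; first by rewrite expr0 scale1r.
  by rewrite exprZn -scalerAl -scalerAr scalerA -exprM mulnC -exprD.
rewrite /theta /= /mmap raddf_sum /=.
have tE k : ((z@_k)%:MP * mmap1 theta_var k)@_m = (k == m)%:R * (2 ^+ mnmwgt m * z@_m).
  rewrite h1 mul_mpolyC mcoeffZ mcoeffZ mcoeffX; case: eqP => [->|_].
    by rewrite mulr1 mul1r mulrC.
  by rewrite !mulr0 mul0r.
rewrite (eq_bigr _ (fun k _ => tE k)); have [mz|mz] := boolP (m \in msupp z).
  rewrite (bigD1_seq m) ?msupp_uniq //= eqxx mul1r big1 ?addr0 // => k /negbTE ->.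
  by rewrite mul0r.
rewrite (memN_msupp_eq0 mz) mulr0 big1 // => k _; by rewrite mulr0.
Qed.

Lemma theta_X (i : 'I_4) : theta 'X_i = 2 ^+ i.+1 * 'X_i.
Proof.
by rewrite /theta /= mmapX mmap1U /theta_var -!natrX scaler_nat mulr_natl.
Qed.

(** Both series solve the curve with parameters [2 ^+ i * p_i], and that solution is unique. *)
Lemma scale_calB : mps_map theta calB = mps_scale calB.
Proof.
have := on_curve_map theta on_curve_calB; rewrite /p1 /p2 /p3 /p4 !theta_X /= => h.
exact: on_curve_uniq torsion_freeQp h (on_curve_scale on_curve_calB).
Qed.

Section Scaling.
Local Notation t := (mpsX ord0 : mps 1 Qp).
Local Notation D1 := (mps_deriv (ord0 : 'I_1)).

Lemma law_curve H : buchstaber_form H calA calB ->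
  4 * (H * den calB) = num (4 * calB ^+ 2 - 2 * t * calB * D1 calB + mpsC p1 * t * calB).
Proof.
case=> _ b0; rewrite -/(inx calA) -/(iny calA) -/(inx calB) -/(iny calB).
rewrite -/(num calA) -/(den calB) -calA4 => ->; rewrite -(num_shift _ calK).
by rewrite /num (inxM 4) (inyM 4) inx_nat iny_nat; ring.
Qed.

(** This is homogeneity, [F(2x, 2y) = 2 theta(F)(x, y)]. Both operations are applied to [E4]; they
    agree on [calB] and on the argument of [num], while scaling multiplies [den] by 2 and [num] by
    4. *)
Lemma scale_law H : buchstaber_form H calA calB -> mps_scale H = 2 * mps_map theta H.
Proof.
move=> HE; have [_ b0 _] := HE.
(* [euler] replaces [t * D1] because it commutes with scaling as well as with [theta]. *)
pose N (q : Qp) (b : mps 1 Qp) := 4 * b ^+ 2 - 2 * b * euler b + mpsC q * t * b.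
have E4 : 4 * (H * den calB) = num (N p1 calB).
  by rewrite law_curve // /N eulerE; congr num; ring.
have sc_in (f : mps 1 Qp) : mps_scale (inx f) = inx (mps_scale f).
  exact: mps_scale_subst.
have sc_iny (f : mps 1 Qp) : mps_scale (iny f) = iny (mps_scale f).
  exact: mps_scale_subst.
have tp1 : theta p1 = 2 * p1 by rewrite /p1 theta_X.
have mapN : mps_map theta (N p1 calB) = N (2 * p1) (mps_scale calB).
  rewrite /N (mps_natE 1 _ 4) (mps_natE 1 _ 2).
  rewrite !(mps_mapD, mps_mapN, mps_mapM, mps_mapXn, mps_mapC) mps_mapX mps_map_euler.
  by rewrite scale_calB tp1 !rmorph_nat.
have scN : mps_scale (N p1 calB) = N (2 * p1) (mps_scale calB).
  rewrite /N (mps_natE 1 _ 4) (mps_natE 1 _ 2).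
  rewrite !(mps_scaleD, mps_scaleN, mps_scaleM, mps_scaleXn, mps_scaleC) mps_scaleX.
  rewrite mps_scale_euler.
  by rewrite mpsC_mul (mps_natE 1 _ 2); ring.
have mE := congr1 (mps_map theta) E4; have sE := congr1 (@mps_scale 2 Qp) E4.
rewrite (mps_natE 2 _ 4) in mE sE.
rewrite /num /den !(mps_mapD, mps_mapN, mps_mapM, mps_mapXn, mps_mapC) !map_inx !map_iny in mE.
rewrite !mps_mapX mapN scale_calB in mE.
rewrite /num /den !(mps_scaleD, mps_scaleN, mps_scaleM, mps_scaleXn, mps_scaleC) !sc_in !sc_iny in sE.
rewrite !mps_scaleX scN in sE.
rewrite rmorph_nat -!(mps_natE 2 _ 4) in mE sE.
apply/eqP; rewrite -subr_eq0; apply/eqP.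
(* The factor 8 combines the 4 of [E4] with the 2 coming from the scaled [den]. *)
apply: (torsion_freeM (n := 7) (torsion_free_mps torsion_freeQp)).
apply: (@den_regular _ (mps_scale calB)); first by rewrite /= mdeg0 mul1r.
apply: (lincomb (c := -1) (c' := 4) sE mE); rewrite /den; ring.
Qed.

(** In [scale_law], a monomial of weight [w] occurring in [H m] is multiplied by [2 ^+ mdeg m] on
    one side and by [2 ^+ w.+1] on the other; distinct powers of 2 differ in [rat], so
    [w = mdeg m - 1]. *)
Lemma law_degree H m : buchstaber_form H calA calB -> (0 < mdeg m)%N ->
  Qp_degree (2 * (mdeg m - 1)) (H m).
Proof.
move=> /scale_law HE m_gt0 k; have := congr1 (fun F : mps 2 Qp => (F m)@_k) HE.
have two e (z : Qp) : (2 ^+ e * z)@_k = 2 ^+ e * z@_k.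
  by rewrite -!natrX !mulr_natl mcoeffMn.
have -> : (mps_scale H m)@_k = 2 ^+ mdeg m * (H m)@_k := two _ _.
have -> : ((2 * mps_map theta H) m)@_k = 2 ^+ (mnmwgt k).+1 * (H m)@_k.
  by rewrite mulr_natl mcoefMn mcoeffMn theta_coef [in RHS]exprS -mulrA mulr_natl.
move=> e; rewrite mcoeff_msupp => nz; move/(mulIf nz)/eqP: e.
rewrite -!natrX Num.Theory.eqr_nat eqn_exp2l // => /eqP ->.
by rewrite subn1.
Qed.

End Scaling.

(** * Universality *)

Lemma rmorphism_ext (R S : comPzRingType) (f : R -> S) :
  (forall a b, f (a - b) = f a - f b) -> f 1 = 1 -> {morph f : a b / a * b} ->
  exists g : {rmorphism R -> S}, g =1 f.
Proof.
move=> fB f1 fM.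
pose mA := GRing.isZmodMorphism.Build R S f fB.
pose mM := GRing.isMonoidMorphism.Build R S f (conj f1 fM).
pose g : {rmorphism R -> S} := HB.pack f mA mM.
by exists g.
Qed.

Lemma map_fgl (R S : comPzRingType) (phi : {rmorphism R -> S}) (F : mps 2 R) :
  is_fgl F -> is_fgl (mps_map phi F).
Proof.
case=> F1 F2 FC FA; split.
- by have := congr1 (mps_map phi) F1; rewrite mps_map_subst2 !mps_mapX mps_map0.
- by have := congr1 (mps_map phi) F2; rewrite mps_map_subst2 !mps_mapX mps_map0.
- by have := congr1 (mps_map phi) FC; rewrite mps_map_subst2 !mps_mapX.
- by have := congr1 (mps_map phi) FA; rewrite !mps_map_subst2 !mps_mapX.
Qed.

Lemma map_buchstaber (R S : comPzRingType) (phi : {rmorphism R -> S}) (F : mps 2 R) :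
  is_buchstaber F -> is_buchstaber (mps_map phi F).
Proof.
case=> FG [A [B [A0 B0 FE]]]; split; first exact: map_fgl.
exists (mps_map phi A), (mps_map phi B); split; rewrite /= ?A0 ?B0 ?rmorph1 //.
have := congr1 (mps_map phi) FE.
by rewrite -/(den B) -/(num A) mps_mapM map_den map_num.
Qed.

Lemma mps_map_nat n (R S : comPzRingType) (phi : {rmorphism R -> S}) k :
  mps_map phi (k%:R : mps n R) = k%:R.
Proof. by elim: k => [|k IH]; rewrite ?mps_map0 // -!natr1 mps_mapD IH mps_map1. Qed.

Lemma eval_exists_nz (S : comNzRingType) (iota : {rmorphism rat -> S}) (h : 'I_4 -> S) :
  exists2 psi : {rmorphism Qp -> S},
    (forall q, psi q%:MP = iota q) & forall i, psi 'X_i = h i.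
Proof.
exists (mmap iota h : {rmorphism Qp -> S}) => [q|i] /=; first by rewrite mmapC.
by rewrite mmapX mmap1U.
Qed.

(** The hypothesis equips [S] with the nonzero ring structure that [eval_exists_nz] expects. *)
Lemma eval_exists (S : comPzRingType) (iota : {rmorphism rat -> S}) (h : 'I_4 -> S) :
  (1 : S) != 0 ->
  exists2 psi : {rmorphism Qp -> S},
    (forall q, psi q%:MP = iota q) & forall i, psi 'X_i = h i.
Proof.
move=> nz.
pose S' : comNzRingType := HB.pack (S : Type) (GRing.PzSemiRing_isNonZero.Build S nz) S.
exact: (@eval_exists_nz S' iota h).
Qed.

(** [psi] sends the [p_i] to the parameters of the curve of [G]. Uniqueness on the curve carries
    [calB] to [dG/dy(x,0)]; both laws then have the same numerator and denominator, and [den] is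
    regular. *)
Lemma classify (S : comPzRingType) (iota : {rmorphism rat -> S}) (G : mps 2 S) H :
  (1 : S) != 0 -> buchstaber_form H calA calB -> is_buchstaber G ->
  exists2 psi : {rmorphism Qp -> S}, (forall q, psi q%:MP = iota q) & mps_map psi H = G.
Proof.
move=> nz HE [GG [A [B GE]]].
have tf : torsion_free S.
  move=> a n a0; rewrite -[a]mul1r -(rmorph1 iota).
  have -> : 1 = n.+1%:R^-1 * n.+1%:R :> rat by rewrite mulVf // Num.Theory.pnatr_eq0.
  by rewrite rmorphM rmorph_nat -mulrA mulr_natl a0 mulr0.
have [q1 [q2 [q3 [q4 [curve GN]]]]] := buchstaber_curve tf GG GE.
move: curve GN; set b := aty0 _ => curve GN.
have [psi psiC psiX] := eval_exists iota (fun i => nth 0 [:: q1; q2; q3; q4] i) nz.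
exists psi => //.
have psiB : mps_map psi calB = b.
  have := on_curve_map psi on_curve_calB; rewrite /p1 /p2 /p3 /p4 !psiX => c.
  exact: on_curve_uniq tf c curve.
have := congr1 (mps_map psi) (law_curve HE).
rewrite mps_mapM mps_mapM map_den map_num.
rewrite !(mps_map_nat, mps_mapD, mps_mapN, mps_mapXn, mps_mapC, mps_mapM).
rewrite mps_mapX mps_map_deriv psiB /p1 psiX -GN => /eqP; rewrite -subr_eq0 -mulrBr => /eqP.
move=> /(torsion_freeM (torsion_free_mps tf)); rewrite -mulrBl mulrC => e.
apply/eqP; rewrite -subr_eq0; apply/eqP; apply: den_regular e.
by case: curve.
Qed.

Lemma biadditive0 (U V W : zmodType) (b : U -> V -> W) : biadditive b ->
  (forall v, b 0 v = 0) /\ (forall u, b u 0 = 0).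
Proof.
case=> bl br; split=> [v|u]; first by apply: (addrI (b 0 v)); rewrite -bl !addr0.
by apply: (addrI (b u 0)); rewrite -br !addr0.
Qed.

Lemma biadditiveN (U V W : zmodType) (b : U -> V -> W) : biadditive b ->
  (forall u v, b (- u) v = - b u v) /\ (forall u v, b u (- v) = - b u v).
Proof.
move=> bb; have [b0l b0r] := biadditive0 bb; case: bb => bl br; split=> u v.
  by apply: (addrI (b u v)); rewrite -bl !subrr.
by apply: (addrI (b u v)); rewrite -br !subrr.
Qed.

(** * The rational tensor product: morphisms and degrees *)

Section TensorQ.
Variables (L T : comPzRingType) (t : L -> rat -> T).
Hypothesis t_tensor : is_tensorQ t.

Let t_bi : biadditive t. Proof. by case: t_tensor. Qed.
Let t11 : t 1 1 = 1. Proof. by case: t_tensor. Qed.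
Let tM a a' q q' : t a q * t a' q' = t (a * a') (q * q').
Proof. by case: t_tensor. Qed.

Lemma tensorQ_ratl : exists iota : {rmorphism rat -> T}, iota =1 t 1.
Proof.
apply: rmorphism_ext => [q r||q r] //; last by rewrite tM mulr1.
by rewrite t_bi.2 (biadditiveN t_bi).2.
Qed.

Lemma tensorQ_inl : exists j : {rmorphism L -> T}, j =1 t^~ 1.
Proof.
apply: rmorphism_ext => [a b||a b] /=; last by rewrite tM mulr1.
  by rewrite t_bi.1 (biadditiveN t_bi).1.
exact: t11.
Qed.

Lemma tensorQ_eq (M : zmodType) (h k : {additive T -> M}) :
  (forall a q, h (t a q) = k (t a q)) -> h =1 k.
Proof.
move=> hk; case: t_tensor => _ uni _ _.
apply: (uni M (fun a q => k (t a q)) _).2 => //.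
by split=> *; rewrite ?t_bi.1 ?t_bi.2 raddfD.
Qed.

Lemma tensorQ_lift (S : comPzRingType) (iota : {rmorphism rat -> S})
    (f : {rmorphism L -> S}) :
  exists phi : {rmorphism T -> S}, forall a q, phi (t a q) = iota q * f a.
Proof.
case: (t_tensor) => _ uni _ _.
have [|[h hE] _] := uni S (fun a q => iota q * f a).
  by split=> *; rewrite rmorphD ?mulrDl ?mulrDr.
(* Multiplicativity equates additive maps in each argument, so [tensorQ_eq] reduces it to pure
   tensors, one factor at a time. *)
have hM : {morph h : a b / a * b}.
  have hM1 a q w : h (t a q * w) = h (t a q) * h w.
    pose k : {additive T -> S} := h \o (t a q \*o idfun).
    pose k' : {additive T -> S} := h (t a q) \*o h.
    have kk : k =1 k'.
      by apply: tensorQ_eq => b r /=; rewrite tM !hE !rmorphM mulrACA.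
    exact: kk.
  move=> z w; pose k : {additive T -> S} := h \o (w \*o idfun).
  pose k' : {additive T -> S} := h w \*o h.
  have kk : k =1 k' by apply: tensorQ_eq => b r /=; rewrite mulrC hM1 mulrC.
  by rewrite mulrC [RHS]mulrC; apply: kk.
have [||phi phiE] := rmorphism_ext _ _ hM; first exact: raddfB.
  by rewrite -t11 hE !rmorph1 mulr1.
by exists phi => a q; rewrite phiE hE.
Qed.

Variable F : mps 2 L.
Local Notation deg := (tensorQ_degree t F).

Lemma tensorQ_degree_t d a q : coef_degree F d a -> deg d (t a q).
Proof.
move=> ad; exists [:: (a, q)]; last by rewrite big_seq1.
by move=> u; rewrite inE => /eqP ->.
Qed.

Lemma tensorQ_degree0 d : deg d 0.
Proof. by exists [::] => //; rewrite big_nil. Qed.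

Lemma tensorQ_degreeD d z w : deg d z -> deg d w -> deg d (z + w).
Proof.
move=> [s sd ->] [r rd ->]; exists (s ++ r); last by rewrite big_cat.
by move=> u; rewrite mem_cat => /orP[/sd|/rd].
Qed.

Lemma tensorQ_degreeN d z : deg d z -> deg d (- z).
Proof.
move=> [s sd ->]; exists [seq (u.1, - u.2) | u <- s].
  by move=> u /mapP[v /sd vd ->].
by rewrite big_map -sumrN; apply: eq_bigr => u _; rewrite (biadditiveN t_bi).2.
Qed.

Lemma tensorQ_degreeM d e z w : deg d z -> deg e w -> deg (d + e) (z * w).
Proof.
move=> [s sd ->] [r rd ->].
exists [seq (u.1 * v.1, u.2 * v.2) | u <- s, v <- r].
  by move=> u /allpairsP[[v v'] /= [/sd ? /rd ? ->]]; apply: coef_degree_M.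
rewrite big_allpairs_dep mulr_suml; apply: eq_bigr => u _.
by rewrite mulr_sumr; apply: eq_bigr => v _; rewrite tM.
Qed.

End TensorQ.

Lemma Qp_degree0 d : Qp_degree d 0.
Proof. by move=> m; rewrite msupp0. Qed.

Lemma Qp_degreeD d z w : Qp_degree d z -> Qp_degree d w -> Qp_degree d (z + w).
Proof. by move=> zd wd m /msuppD_le; rewrite mem_cat => /orP[/zd|/wd]. Qed.

Lemma Qp_degreeZ d c z : Qp_degree d z -> Qp_degree d (c *: z).
Proof. by move=> zd m /msuppZ_le /zd. Qed.

Lemma Qp_degreeM d e z w : Qp_degree d z -> Qp_degree e w -> Qp_degree (d + e) (z * w).
Proof.
move=> zd we m /msuppM_le /allpairsP[[k l] /= [/zd kd /we le ->]].
by rewrite mnmwgtD mulnDr kd le.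
Qed.

Lemma coef_degree_Qp (L : comPzRingType) (F : mps 2 L) (f : {rmorphism L -> Qp}) H d a :
  buchstaber_form H calA calB -> mps_map f F = H -> coef_degree F d a ->
  Qp_degree d (f a).
Proof.
move=> HE FH; elim=> [m m0||d' e a' b _ IHa _ IHb|d'|d' a' b _ IHa _ IHb].
- rewrite -[f (F m)]/(mps_map f F m) FH; exact: law_degree.
- by move=> m; rewrite rmorph1 msupp1 inE => /eqP ->; rewrite mnmwgt0.
- by rewrite rmorphM; apply: Qp_degreeM.
- by rewrite rmorph0; apply: Qp_degree0.
- by rewrite rmorphB -scaleN1r; apply: Qp_degreeD => //; apply: Qp_degreeZ.
Qed.

(* The parameters of the curve are polynomials in the coefficients of the law, so the
   image of the tensor product contains them in the right degrees. *)
Lemma tensorQ_degree_onto (L T : comPzRingType) (t : L -> rat -> T) (F : mps 2 L)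
    (f : {rmorphism L -> Qp}) (phi : {rmorphism T -> Qp}) H :
  is_tensorQ t -> (forall a q, phi (t a q) = q%:MP * f a) ->
  aty0 (mps_deriv ord_max H) = calB -> mps_map f F = H ->
  forall d z, Qp_degree d z -> exists2 w, tensorQ_degree t F d w & phi w = z.
Proof.
move=> tt phiE HB FH.
pose Gr d z := exists2 w, tensorQ_degree t F d w & phi w = z.
have Gr0 d : Gr d 0 by exists 0; rewrite ?rmorph0 //; apply: tensorQ_degree0.
have Grt d a q : coef_degree F d a -> Gr d (q%:MP * f a).
  by move=> ad; exists (t a q); rewrite ?phiE //; apply: tensorQ_degree_t.
have GrC q : Gr 0%N q%:MP.
  by have := Grt 0%N 1 q (coef_degree_1 F); rewrite rmorph1 mulr1.
have GrD d a b : Gr d a -> Gr d b -> Gr d (a + b).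
  move=> [v vd <-] [w wd <-]; exists (v + w); last by rewrite rmorphD.
  exact: tensorQ_degreeD.
have GrM d e a b : Gr d a -> Gr e b -> Gr (d + e)%N (a * b).
  move=> [v vd <-] [w we <-]; exists (v * w); last by rewrite rmorphM.
  exact: tensorQ_degreeM.
have GrB d a b : Gr d a -> Gr d b -> Gr d (a - b).
  move=> [v vd <-] [w wd <-]; exists (v - w); last by rewrite rmorphB.
  by apply: tensorQ_degreeD => //; apply: tensorQ_degreeN.
(* This is the coefficient of [x^k y] in [H] for [k = mdeg m], of degree [2 (k + 1 - 1)]. *)
have GrCB m : Gr (2 * mdeg m)%N (calB m).
  rewrite -HB aty0E /= -FH mulmnE mnm1E mul0n mulr1n.
  have := Grt _ _ 1 (coef_degree_coef F (m := (U_(ord0) *+ mdeg m + U_(ord_max))%MM) _).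
  by rewrite mdegD mdegMn !mdeg1 mul1n addn1 subn1 mul1r; apply.
have [] := @on_curve_graded Qp (fun d => Gr (2 * d)%N) _ _ _ _ _ _ _ _ _ on_curve_calB GrCB.
- by move=> d.
- exact: (GrC 1).
- by move=> d a b; apply: GrB.
- by move=> d e a b; rewrite mulnDr; apply: GrM.
move=> G1 G2 G3 G4.
have GX (i : 'I_4) : Gr (2 * i.+1)%N 'X_i.
  by case: i => [[|[|[|[|]]]]] // lt; rewrite (bool_irrelevance lt isT).
have GXn (i : 'I_4) k : Gr (2 * (k * i.+1))%N ('X_i ^+ k).
  elim: k => [|k IH]; first exact: (GrC 1).
  by rewrite exprS [(k.+1 * _)%N]mulSn mulnDr; apply: GrM.
have Gmon m : Gr (2 * mnmwgt m)%N 'X_[m].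
  rewrite mpolyXE_id /mnmwgt; elim/big_rec2: _ => [|i d z _ IH]; first exact: (GrC 1).
  by rewrite mulnDr; apply: GrM.
move=> d z zd; rewrite -/(Gr d z) [z]mpolyE big_seq.
elim/big_rec: _ => [//|m w mz IH]; apply: GrD => //.
by rewrite -(zd m mz) -mul_mpolyC -[(2 * _)%N]add0n; apply: GrM.
Qed.

Theorem theorem1p1 (L : comPzRingType) (F : mps 2 L)
    (F_univ : universal_buchstaber F)
    (LQ : comPzRingType) (t : L -> rat -> LQ) (t_tensor : is_tensorQ t) :
  exists phi : {rmorphism LQ -> Qp},
    graded_iso t F phi /\
    let G : mps 2 Qp := mps_map (fun a => phi (t a 1)) F in
    [/\ buchstaber_form G calA calB,
        normalized G calA calB
      & forall l : mps 1 Qp, is_log G l <-> l = mps_int (mpsV calB)].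
Proof.
have [b0 _] := calBP; have [H Ht dH] := law_exists b0.
have HE := calB_law Ht dH; have HG := law_fgl b0 Ht dH; have HB := law_invdiff b0 Ht dH.
have HBu : is_buchstaber H by split=> //; exists calA, calB.
have [FB uni] := F_univ; have [[f fF] _] := uni _ _ HBu.
have [phi phiE] := tensorQ_lift t_tensor (@mpolyC 4 rat : {rmorphism rat -> Qp}) f.
have [iota iotaE] := tensorQ_ratl t_tensor; have [j jE] := tensorQ_inl t_tensor.
(* [LQ] is nonzero because it maps to [Qp]; this allows evaluation of polynomials in it. *)
have nz : (1 : LQ) != 0.
  apply/eqP => /(congr1 phi); rewrite rmorph1 rmorph0; apply/eqP; exact: oner_neq0.
have [psi psiC psiH] := classify iota nz HE (map_buchstaber j FB).
(* Both morphisms send [F] to its image over [LQ], and [F] is universal. *)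
have psif : psi \o f =1 j.
  apply: (uni _ _ (map_buchstaber j FB)).2 => //.
  by rewrite -[RHS]psiH -fF; apply: mpsP.
have phiK : cancel phi psi.
  move=> z; apply: (@tensorQ_eq _ _ _ t_tensor _ (psi \o phi) idfun) => a q /=.
  rewrite phiE rmorphM /= psiC iotaE -[psi (f a)]/((psi \o f) a) psif jE.
  by case: t_tensor => _ _ _ ->; rewrite mul1r mulr1.
have onto := tensorQ_degree_onto t_tensor phiE HB fF.
(* [psi] is already a left inverse of [phi], so surjectivity suffices; each term of a polynomial is
   homogeneous and lies in the image by [onto]. *)
have psiK : cancel psi phi.
  move=> z; suff [w <-] : exists w, phi w = z by rewrite phiK.
  rewrite [z]mpolyE; elim/big_rec: _ => [|m w _ [v <-]]; first by exists 0; rewrite rmorph0.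
  have [|u _ <-] := onto (2 * mnmwgt m)%N (z@_m *: 'X_[m]).
    by apply: Qp_degreeZ => k; rewrite msuppX inE => /eqP ->.
  by exists (u + v); rewrite rmorphD.
exists phi; split.
  split; first by exists psi.
  (* If [phi z] is homogeneous, [onto] yields a preimage of the right degree, which is [z] by
     injectivity. *)
  move=> d z; split=> [[s sd ->]|/onto[w wd /(can_inj phiK) <- //]].
  rewrite rmorph_sum big_seq; elim/big_rec: _ => [|u w us wd]; first exact: Qp_degree0.
  apply: Qp_degreeD => //; rewrite phiE mul_mpolyC; apply: Qp_degreeZ.
  exact: coef_degree_Qp HE fF (sd u us).
have -> : mps_map (fun a => phi (t a 1)) F = H.
  by rewrite -fF; apply: mpsP => m /=; rewrite phiE mul1r.
split=> //; first exact: calB_normalized.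
by move=> l; apply: is_logP.
Qed.
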